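(* Let $\mathcal M(A,B)\subset{}^d\mathcal K$ be maximal isotropic, and let $\mathsf k\in\mathbb C$ with $\operatorname{Im}\mathsf k\geq0$ and $\lambda=\mathsf k^2\in\mathbb R\setminus\{0\}$. Assume $\mathcal I\neq\emptyset$. Then $\lambda=\mathsf k^2$ with $\det(A+i\mathsf kB)\neq0$ is an eigenvalue of $-\Delta(\mathcal M(A,B),\underline a)$ with multiplicity $m$ if and only if $1$ is an eigenvalue of $\mathfrak S(\mathsf k;A,B)T(\mathsf k;\underline a)$ with geometric multiplicity $m$. If $\mathcal I=\emptyset$, then $\lambda=-\varkappa^2<0$ ($\varkappa>0$) is an eigenvalue of $-\Delta(\mathcal M(A,B))$ with multiplicity $m$ if and only if $0$ is an eigenvalue of $A-\varkappa B$ with geometric multiplicity $m$.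
   Context: Let $\mathcal G=(V,\mathcal I,\mathcal E,\partial)$ be a finite connected graph with internal edges $\mathcal I$ (intervals $I_i=[0,a_i]$, $a_i>0$, $\underline a=\{a_i\}$) and external edges $\mathcal E$ (half-lines $I_e=[0,\infty)$). $\mathcal H=\bigoplus_jL^2(I_j)$; $\mathcal D$ = $\psi\in\mathcal H$ with $\psi_j,\psi_j'$ absolutely continuous, $\psi_j''\in L^2$. $\mathcal K=\mathcal K_{\mathcal E}\oplus\mathcal K^{(-)}_{\mathcal I}\oplus\mathcal K^{(+)}_{\mathcal I}\cong\mathbb C^{|\mathcal E|}\oplus\mathbb C^{|\mathcal I|}\oplus\mathbb C^{|\mathcal I|}$, ${}^d\mathcal K=\mathcal K\oplus\mathcal K$. For $\psi\in\mathcal D$: $\underline\psi=(\{\psi_e(0)\},\{\psi_i(0)\},\{\psi_i(a_i)\})$, $\underline\psi'=(\{\psi_e'(0)\},\{\psi_i'(0)\},\{-\psi_i'(a_i)\})$. For linear $A,B:\mathcal K\to\mathcal K$ with $(A,B):{}^d\mathcal K\to\mathcal K$ of rank $|\mathcal E|+2|\mathcal I|$ and $AB^\dagger$ self-adjoint, $\mathcal M(A,B)=\{\chi_1\oplus\chi_2:A\chi_1+B\chi_2=0\}$ is maximal isotropic, and $\Delta(\mathcal M(A,B),\underline a)$ is the self-adjoint operator $(\Delta\psi)_j=\psi_j''$ on $\{\psi\in\mathcal D:A\underline\psi+B\underline\psi'=0\}$ (written $\Delta(\mathcal M(A,B))$ if $\mathcal I=\emptyset$). For $\det(A+i\mathsf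 kB)\neq0$, $\mathfrak S(\mathsf k;A,B)=-(A+i\mathsf kB)^{-1}(A-i\mathsf kB)$. With respect to $\mathcal K=\mathcal K_{\mathcal E}\oplus\mathcal K^{(-)}_{\mathcal I}\oplus\mathcal K^{(+)}_{\mathcal I}$, $T(\mathsf k;\underline a)=\begin{pmatrix}0&0&0\\0&0&e^{i\mathsf k\underline a}\\0&e^{i\mathsf k\underline a}&0\end{pmatrix}$, where $e^{i\mathsf k\underline a}$ is the diagonal $|\mathcal I|\times|\mathcal I|$ matrix with entries $e^{i\mathsf ka_i}$. *)

(* Defs.v *)
From HB Require Import structures.
From mathcomp Require Import all_boot all_order all_algebra.
From mathcomp Require Import all_classical all_reals all_analysis.
From mathcomp Require Import complex.
Import Order.TTheory GRing.Theory Num.Theory.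

Set Implicit Arguments.
Unset Strict Implicit.
Unset Printing Implicit Defensive.

Local Open Scope ring_scope.
Local Open Scope classical_set_scope.

Section QuantumGraph.
Variable R : realType.
Local Notation C := R[i].

Definition abs_cont_on (s t : R) (f : R -> R) : Prop :=
  forall e : R, 0 < e -> exists2 d : R, 0 < d &
    forall (n : nat) (u v : 'I_n -> R),
      (forall k, s <= u k /\ u k <= v k /\ v k <= t) ->
      (forall k l, k != l -> v k <= u l \/ v l <= u k) ->
      \sum_(k < n) (v k - u k) < d ->
      \sum_(k < n) `|f (v k) - f (u k)| < e.

(* (Local) absolute continuity on an interval J: absolutely continuous
   on every compact subinterval of J (for J = [0,a] this is plain AC on
   [0,a]; for J = [0,oo) it is local AC). *)
Definition loc_abs_cont (J : set R) (f : R -> R) : Prop :=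
  forall s t, J s -> J t -> abs_cont_on s t f.

Definition cabs_cont (J : set R) (f : R -> C) : Prop :=
  loc_abs_cont J (fun x => complex.Re (f x)) /\ loc_abs_cont J (fun x => complex.Im (f x)).

Definition cderivable (f : R -> C) (x : R) : Prop :=
  derivable (fun y => complex.Re (f y)) x 1 /\ derivable (fun y => complex.Im (f y)) x 1.

Definition cderive (f : R -> C) (x : R) : C :=
  ((fun y => complex.Re (f y))^`() x +i* (fun y => complex.Im (f y))^`() x)%C.

Definition L2 (J : set R) (f : R -> C) : Prop :=
  (\int[@lebesgue_measure R]_(x in J) ((complex.Re (f x)) ^+ 2 + (complex.Im (f x)) ^+ 2)%:E
     < +oo)%E.

(* On an edge with closed parameter interval J and open interior Jo,
   [psi] is in the maximal domain (psi, psi' absolutely continuous,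
   psi, psi'' in L^2), with [dpsi] the (continuous) derivative psi', and
   satisfies -psi'' = lam psi (as elements of L^2, i.e. a.e.). *)
Definition edge_eigen (J Jo : set R) (lam : R) (psi dpsi : R -> C) : Prop :=
  [/\ cabs_cont J psi /\ cabs_cont J dpsi,
      (forall x, Jo x -> cderivable psi x /\ cderive psi x = dpsi x),
      (\forall x \ae (@lebesgue_measure R),
          (Jo x -> (cderivable dpsi x /\ - cderive dpsi x = (lam%:C)%C * psi x))),
      L2 J psi & L2 J (cderive dpsi)].

Definition bvec (nE nI : nat) (fE : 'I_nE -> C) (fm fp : 'I_nI -> C)
  : 'cV[C]_(nE + nI + nI) :=
  \col_(k < nE + nI + nI) match fintype.split k with
         | inl k' => match fintype.split k' with inl e => fE e | inr i => fm i end
         | inr i => fp i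
         end.

(* (psiE, psiI) is an eigenfunction of -Delta(M(A,B), a) for lam
   (or the zero function): external edges [0,oo), internal edges [0, a_i]. *)
Definition is_eigfun (nE nI : nat) (a : 'I_nI -> R)
  (A B : 'M[C]_(nE + nI + nI)) (lam : R)
  (psiE : 'I_nE -> R -> C) (psiI : 'I_nI -> R -> C) : Prop :=
  exists (dE : 'I_nE -> R -> C) (dI : 'I_nI -> R -> C),
  [/\ (forall e, edge_eigen `[0, +oo[ `]0, +oo[ lam (psiE e) (dE e)),
      (forall i, edge_eigen `[0, a i] `]0, a i[ lam (psiI i) (dI i)) &
      A *m bvec (fun e => psiE e 0) (fun i => psiI i 0) (fun i => psiI i (a i))
    + B *m bvec (fun e => dE e 0) (fun i => dI i 0) (fun i => - dI i (a i))
    = 0].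

Definition lin_indep (nE nI : nat) (a : 'I_nI -> R) (n : nat)
  (FE : 'I_n -> 'I_nE -> R -> C) (FI : 'I_n -> 'I_nI -> R -> C) : Prop :=
  forall c : 'I_n -> C,
    (forall e x, 0 <= x -> \sum_(l < n) c l * FE l e x = 0) ->
    (forall i x, 0 <= x <= a i -> \sum_(l < n) c l * FI l i x = 0) ->
    forall l, c l = 0.

Definition eig_mult (nE nI : nat) (a : 'I_nI -> R)
  (A B : 'M[C]_(nE + nI + nI)) (lam : R) (m : nat) : Prop :=
  (exists (FE : 'I_m -> 'I_nE -> R -> C) (FI : 'I_m -> 'I_nI -> R -> C),
      (forall l, is_eigfun a A B lam (FE l) (FI l)) /\ lin_indep a FE FI)
  /\
  (forall (FE : 'I_m.+1 -> 'I_nE -> R -> C) (FI : 'I_m.+1 -> 'I_nI -> R -> C),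
      (forall l, is_eigfun a A B lam (FE l) (FI l)) -> ~ lin_indep a FE FI).

Definition cexp (z : C) : C :=
  ((expR (complex.Re z))%:C * (cos (complex.Im z) +i* sin (complex.Im z)))%C.

Definition mxadj (n : nat) (M : 'M[C]_n) : 'M[C]_n := (map_mx conjc M)^T.

Definition Smat (n : nat) (k : C) (A B : 'M[C]_n) : 'M[C]_n :=
  - (invmx (A + ('i%C * k) *: B) *m (A - ('i%C * k) *: B)).

Definition Tmat (nE nI : nat) (k : C) (a : 'I_nI -> R) : 'M[C]_(nE + nI + nI) :=
  let D : 'M[C]_nI := diag_mx (\row_i cexp ('i%C * k * ((a i)%:C)%C)) in
  block_mx 0 (col_mx 0 D) (row_mx 0 D) 0.

End QuantumGraph.

(* Main.v *)
(* On an edge the real and imaginary parts of an eigenfunction [psi] solve [f'' = - lam f]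
   almost everywhere. With [c, s] the solutions having Cauchy data [(1, 0)] and [(0, 1)], the
   functions [c f - s f'] and [lam s f + c f'] are absolutely continuous with almost
   everywhere vanishing derivative, hence constant, so that [psi = psi(0) c + psi'(0) s].
   On a half-line, square integrability forces [psi'(0) = ik psi(0)], and [psi = 0] when
   [k] is real.

   Put [w = ik]. If [u, u'] are the boundary vectors of an eigenfunction and
   [chi = (u + u' / w) / 2], then [T chi = (u - u' / w) / 2], so the boundary condition
   [A u + B u' = 0] reads [(A (1 + T) + w B (1 - T)) chi = 0], and the left-hand side is
   [(A + w B) (1 - S T) chi]. Thus [chi] parametrizes the eigenspace by the
   kernel of this matrix. For real [k] one has to know that every [chi] in the kernel vanishes
   on the external edges: [S] is unitary, so [chi = S T chi] has the norm of [T chi],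
   which is that of the internal part of [chi]. *)
Require Import Defs.
From HB Require Import structures.
From mathcomp Require Import all_boot all_order all_algebra.
From mathcomp Require Import all_classical all_reals all_analysis.
From mathcomp Require Import complex measurable_realfun.
From mathcomp Require Import ring lra.
Import Order.TTheory GRing.Theory Num.Theory.
Import numFieldNormedType.Exports.
Local Open Scope ring_scope.

Set Implicit Arguments.
Unset Strict Implicit.
Unset Printing Implicit Defensive.

(** * Absolutely continuous functions *)

Section AbsoluteContinuity.
Variable R : realType.
Implicit Types (s t x y e d : R) (f g : R -> R).
Local Notation mu := (@lebesgue_measure R).
Local Open Scope classical_set_scope.

(** The supremum of the points of $[s,t]$ satisfying [P] must be near enough to [t] to be passed in
    one step: otherwise the step leads from a point just below the supremum to one strictly above
    it. *)
Lemma real_induction (P : R -> Prop) s t : s <= t -> P s ->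
  (forall c, s <= c <= t -> exists2 d, 0 < d & forall x y,
     s <= x -> x <= c -> c <= y -> y <= t -> c - d < x -> y < c + d -> P x -> P y) ->
  P t.
Proof.
move=> st Ps step.
pose S := [set x | s <= x <= t /\ P x]%classic.
have Ss : S s by split; rewrite ?lexx.
have Sub : has_ubound S by exists t => x [/andP[]].
have Ssup : has_sup S by split; [exists s|].
have sc : s <= sup S by exact: ub_le_sup.
have ct : sup S <= t by apply: ge_sup; [exists s|move=> x [/andP[]]].
have [|d d0 H] := step (sup S); first by rewrite sc.
have [x [/andP[sx xt] Px] xS] := sup_adherent d0 Ssup.
have xc : x <= sup S by apply: ub_le_sup => //; split; rewrite ?sx.
have [tc|tc] := ltP t (sup S + d); first exact: (H x t).
have Sy : S (sup S + d / 2).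
  split; first by apply/andP; split; lra.
  by apply: (H x) => //; lra.
by have := ub_le_sup Sub Sy; lra.
Qed.

Let le_mu (A B : set R) : measurable A -> measurable B -> A `<=` B -> (mu A <= mu B)%E.
Proof. by move=> mA mB AB; apply: le_measure; rewrite ?inE. Qed.

Let mu_itv_oc x y : x <= y -> mu `]x, y] = (y - x)%:E.
Proof.
move=> xy; rewrite lebesgue_measure_itv/= lte_fin; case: ltP => // yx.
by have -> : y = x by [lra]; rewrite subrr.
Qed.

(* [m x] is the measure of [U] on the left of [x]. *)
Lemma negligible_open_cover (N : set R) d : mu.-negligible N -> 0 < d ->
  exists2 U : set R, open U /\ N `<=` U &
  exists m : R -> R, [/\ (forall x y, x <= y -> m x <= m y), (forall x, 0 <= m x < d) &
    forall x y, x <= y -> `[x, y] `<=` U -> m x + (y - x) <= m y].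
Proof.
move=> [N' [mN' N'0 NN']] d0.
have [U [oU N'U muU]] : exists U : set R,
    [/\ open U , N' `<=` U & (mu (U `\` N') < d%:E)%E].
  apply: lebesgue_regularity_outer => //.
  apply: (@le_lt_trans _ _ 0%E); last by rewrite ltey.
  by rewrite le_eqVlt; apply/orP; left; apply/eqP; exact: N'0.
have mU : measurable U by exact: open_measurable.
have Ud : (mu U < d%:E)%E.
  rewrite -(setDUK N'U) measureU ?setDIK//; last exact: measurableD.
  by rewrite [X in (X + _)%E]N'0 add0e.
exists U; first by split => //; exact: subset_trans N'U.
pose V x := U `&` `]-oo, x].
have mV x : measurable (V x) by exact: measurableI.
have Vlt x : (mu (V x) < d%:E)%E.
  by apply: le_lt_trans _ Ud; apply: le_mu => // z [].
have Vfin x : mu (V x) \is a fin_num.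
  by rewrite ge0_fin_numE//; apply: lt_trans (Vlt x) _; rewrite ltry.
exists (fun x => fine (mu (V x))); split.
- move=> x y xy; apply: fine_le; [exact: Vfin|exact: Vfin|apply: le_mu; [exact: mV|exact: mV|]].
  apply: setIS => z /=; rewrite !in_itv/= => zx; exact: le_trans xy.
- move=> x; apply/andP; split; first exact: fine_ge0.
  by rewrite -lte_fin fineK; [exact: Vlt|exact: Vfin].
(* The part of [U] left of [y] contains the disjoint union of the part left of [x] and $(x,y]$. *)
- move=> x y xy xyU.
  have -> : fine (mu (V x)) + (y - x) = fine (mu (V x `|` `]x, y])).
    rewrite measureU; [|exact: mV|exact: measurable_itv|]; last first.
      apply/seteqP; split=> z //= [[_]]; rewrite in_itv/= => zx.
      move: zx; rewrite in_itv/= => zx /andP[xz].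
      by move: (le_lt_trans zx xz); rewrite ltxx.
    by rewrite [X in (_ + X)%E]mu_itv_oc// fineD; [by []|exact: Vfin|by []].
  have VU : V x `|` `]x, y] `<=` V y.
    move=> z [|]; rewrite /V/= !in_itv/=.
      by move=> [Uz zx]; split => //; exact: le_trans xy.
    move=> /andP[xz zy]; split => //; apply: xyU.
    by rewrite /= in_itv/= zy ltW.
  have mVI : measurable (V x `|` `]x, y]) by apply: measurableU; [exact: mV|exact: measurable_itv].
  have le : (mu (V x `|` `]x, y]) <= mu (V y))%E by apply: le_mu => //; exact: mV.
  apply: fine_le; [|exact: Vfin|exact: le].
  by rewrite ge0_fin_numE//; apply: le_lt_trans le _; apply: lt_trans (Vlt y) _; rewrite ltry.
Qed.

(** Ordered lists replace indexed families, so that an inductive construction can append one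
    interval at the right end. *)
Lemma abs_cont_on_seq s t f e : abs_cont_on s t f -> 0 < e ->
  exists2 d, 0 < d & forall l : seq (R * R),
    all (fun p => [&& s <= p.1, p.1 <= p.2 & p.2 <= t]) l ->
    pairwise (fun p q => p.2 <= q.1) l ->
    \sum_(p <- l) (p.2 - p.1) < d -> \sum_(p <- l) `|f p.2 - f p.1| < e.
Proof.
move=> acf e0; have [d d0 H] := acf e e0; exists d => // l /(all_nthP (0, 0)) al.
move=> /(pairwiseP (0, 0)) pl; rewrite !(big_nth (0, 0)) !big_mkord => ld.
apply: (H (size l) (fun k => (nth (0, 0) l k).1) (fun k => (nth (0, 0) l k).2)) => //.
  by move=> k; have /and3P[] := al k (ltn_ord k).
move=> k k'; rewrite neq_ltn => /orP[kk'|kk']; [left|right]; apply: pl => //;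
  by rewrite inE.
Qed.

Lemma abs_cont_on_unif s t f e : abs_cont_on s t f -> 0 < e ->
  exists2 d, 0 < d & forall x y, s <= x -> x <= y -> y <= t -> y - x < d ->
    `|f y - f x| < e.
Proof.
move=> /abs_cont_on_seq H e0; have [d d0 {}H] := H e e0; exists d => // x y sx xy yt xyd.
have := H [:: (x, y)]; rewrite /= !big_seq1/=; apply => //.
by rewrite sx xy yt.
Qed.

Lemma derive0_small f c e : derivable f c 1 -> f^`() c = 0 -> 0 < e ->
  exists2 d, 0 < d & forall x, `|x - c| < d -> `|f x - f c| <= e * `|x - c|.
Proof.
move=> df f0 e0.
have : (h^-1 *: ((f \o shift c) h%:A - f c)) @[h --> 0^'] --> (0 : R).
  by rewrite -[X in _ --> X]f0 derive1E; exact: df.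
move=> /cvgrPdist_le /(_ _ e0) [d /= d0 H]; exists d => // x xcd.
have [->|xc] := eqVneq x c; first by rewrite !subrr normr0 mulr0.
have := H (x - c); rewrite /= sub0r normrN subr_eq0 => /(_ xcd xc).
rewrite sub0r normrN normrM normfV [_%:A]mulr1 subrK.
by rewrite ler_pdivrMl ?normr_gt0 ?subr_eq0// mulrC.
Qed.

(* Given [e], real induction on [x] shows that [|f x - f s|] is at most [e (x - s)] plus the
   variation of [f] over disjoint intervals contained in a small open set [U] which covers the
   endpoints and the points where [f' = 0] fails. *)
Lemma abs_cont_on_const s t f : s <= t -> abs_cont_on s t f ->
  {ae mu, forall x, s < x < t -> derivable f x 1 /\ f^`() x = 0} -> f t = f s.
Proof.
move=> st acf aef.
pose N := ~` [set x | s < x < t -> derivable f x 1 /\ f^`() x = 0] `|` ([set s] `|` [set t]).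
have negN : mu.-negligible N.
  apply: negligibleU; first exact: aef.
  by apply: negligibleU; apply/negligibleP => //; exact: lebesgue_measure_set1.
suff K e : 0 < e -> `|f t - f s| <= e * (t - s) + e.
  apply/eqP; rewrite -subr_eq0 -normr_eq0 eq_le normr_ge0 andbT.
  apply/ler_addgt0Pl => e e0; rewrite addr0.
  (* For this value the bound $e_1 (t - s) + e_1$ is exactly [e]. *)
  have e1 : 0 < e / (t - s + 1) by apply: divr_gt0 => //; lra.
  apply: le_trans (K _ e1) _; rewrite -[X in _ + X]mulr1 -mulrDr divfK//.
  by apply/eqP; lra.
move=> e0.
have [d d0 dP] := abs_cont_on_seq acf e0.
have [U [oU NU] [m [mle m0 mU]]] := negligible_open_cover negN d0.
suff [l [al pl lm lf]] : exists l : seq (R * R),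
    [/\ all (fun p => [&& s <= p.1, p.1 <= p.2 & p.2 <= t]) l,
     pairwise (fun p q => p.2 <= q.1) l,
     \sum_(p <- l) (p.2 - p.1) <= m t &
     `|f t - f s| <= e * (t - s) + \sum_(p <- l) `|f p.2 - f p.1|].
  apply: le_trans lf _; rewrite lerD2l ltW// dP//.
  by apply: le_lt_trans lm _; have /andP[] := m0 t.
apply: (real_induction (s := s) (P := fun x => exists l : seq (R * R),
    [/\ all (fun p => [&& s <= p.1, p.1 <= p.2 & p.2 <= x]) l,
     pairwise (fun p q => p.2 <= q.1) l,
     \sum_(p <- l) (p.2 - p.1) <= m x &
     `|f x - f s| <= e * (x - s) + \sum_(p <- l) `|f p.2 - f p.1|])) => //.
  exists [::]; split => //; rewrite !big_nil ?subrr ?normr0 ?mulr0 ?addr0//.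
  by have /andP[] := m0 s.
move=> c /andP[sc ct].
(* Near a point of [N] the interval $[x,y]$ lies in [U]; it is appended to the list, and the growth
   of [m] pays for its length. Near any other point $f'(c) = 0$; the list is kept, and the increment
   is charged to $e (y - x)$. *)
have [cN|cN] := pselect (N c).
  have /nbhs_ballP[r /= r0 rU] : nbhs c U by apply: open_nbhs_nbhs; split => //; exact: NU.
  exists r => // x y sx xc cy yt xr yr [l [al pl lm lf]].
  have xyU : (`[x, y] `<=` U)%classic.
    move=> z /=; rewrite in_itv/= => /andP[xz zy]; apply: rU; rewrite /ball/= ltr_norml.
    by apply/andP; split; lra.
  exists (rcons l (x, y)); split.
  - rewrite all_rcons/= sx (le_trans xc cy) lexx/=; apply: sub_all al => p /and3P[-> ->]/= px.
    exact: le_trans px (le_trans xc cy).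
  - rewrite pairwise_rcons pl andbT; apply: sub_all al => p /and3P[_ _]//.
  - rewrite -cats1 big_cat big_seq1/=; have := mU x y (le_trans xc cy) xyU; lra.
  - rewrite -cats1 big_cat big_seq1/=.
    have := ler_normD (f x - f s) (f y - f x).
    have -> : f x - f s + (f y - f x) = f y - f s by ring.
    have : e * (x - s) <= e * (y - s) by rewrite ler_pM2l//; lra.
    move: lf; lra.
have sct : s < c < t.
  rewrite !lt_def sc ct !andbT; apply/andP; split.
    by apply/eqP => E; apply: cN; right; left.
  by apply/eqP => E; apply: cN; right; right.
have [df f0] : derivable f c 1 /\ f^`() c = 0.
  by move: sct; apply: contrapT => H; apply: cN; left.
have [r r0 H] := derive0_small df f0 e0.
exists r => // x y sx xc cy yt xr yr [l [al pl lm lf]].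
exists l; split => //.
- apply: sub_all al => p /and3P[-> ->]/= px; exact: le_trans px (le_trans xc cy).
- by apply: le_trans lm _; apply: mle; exact: le_trans xc cy.
have := H x; rewrite ler0_norm ?subr_le0// => Hx.
have := H y; rewrite ger0_norm ?subr_ge0// => Hy.
have := ler_normD (f x - f s) (f y - f c + (f c - f x)).
have := ler_normD (f y - f c) (f c - f x).
have -> : f x - f s + (f y - f c + (f c - f x)) = f y - f s by ring.
rewrite (distrC (f c)).
have -> : e * (y - s) = e * (x - s) + e * (y - c) + e * - (x - c) by ring.
have {}Hx := Hx ltac:(lra); have {}Hy := Hy ltac:(lra).
by move: Hx Hy lf; lra.
Qed.

(** Over a length below the [d] that belongs to the tolerance $1$ the bound grows by at most $1$;
    real induction carries it to [t]. *)
Lemma abs_cont_on_bounded s t f : abs_cont_on s t f ->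
  exists M : R, forall x, s <= x <= t -> `|f x| <= M.
Proof.
move=> acf; have [st|ts] := leP s t; last first.
  by exists 0 => x /andP[]; lra.
have [d d0 H] := abs_cont_on_unif acf ltr01.
suff [M HM] : exists M : R, forall z, s <= z <= t -> `|f z| <= M by exists M.
apply: (real_induction (s := s)
  (P := fun x => exists M : R, forall z, s <= z <= x -> `|f z| <= M)) => //.
  exists `|f s| => z /andP[sz zs]; have -> // : z = s by lra.
(* Half of [d], since [x] and [y] may lie on opposite sides of [c]. *)
move=> c /andP[sc ct]; exists (d / 2); first by lra.
move=> x y sx xc cy yt xd yd [M HM]; exists (Num.max M (`|f x| + 1)) => z /andP[sz zy].
rewrite le_max; have [zx|xz] := leP z x; first by rewrite HM// sz.
apply/orP; right.
have : `|f z - f x| < 1 by apply: H => //; lra.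
by have := ler_normD (f x) (f z - f x); rewrite addrC subrK; lra.
Qed.

Lemma abs_cont_onD s t f g : abs_cont_on s t f -> abs_cont_on s t g ->
  abs_cont_on s t (fun x => f x + g x).
Proof.
move=> acf acg e e0; have e2 : 0 < e / 2 by rewrite divr_gt0.
have [d d0 H] := acf _ e2; have [d' d'0 H'] := acg _ e2.
exists (Num.min d d'); first by rewrite lt_min d0.
move=> n u v uv dis; rewrite lt_min => /andP[ld ld'].
apply: le_lt_trans (_ : \sum_(k < n) (`|f (v k) - f (u k)| + `|g (v k) - g (u k)|) < _).
  apply: ler_sum => k _; apply: le_trans (ler_normD _ _).
  by rewrite le_eqVlt; apply/orP; left; apply/eqP; congr (`|_|); ring.
rewrite big_split/=; have := H n u v uv dis ld; have := H' n u v uv dis ld'; lra.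
Qed.

Lemma abs_cont_onM s t f g : abs_cont_on s t f -> abs_cont_on s t g ->
  abs_cont_on s t (fun x => f x * g x).
Proof.
move=> acf acg e e0.
have [M HM] := abs_cont_on_bounded acf; have [M' HM'] := abs_cont_on_bounded acg.
(* A strictly positive bound for both factors. *)
pose K := `|M| + `|M'| + 1.
have K0 : 0 < K by rewrite /K; have := normr_ge0 M; have := normr_ge0 M'; lra.
have e2 : 0 < e / 2 / K by rewrite !divr_gt0.
have [d d0 H] := acf _ e2; have [d' d'0 H'] := acg _ e2.
exists (Num.min d d'); first by rewrite lt_min d0.
move=> n u v uv dis; rewrite lt_min => /andP[ld ld'].
apply: le_lt_trans (_ : \sum_(k < n) (K * `|f (v k) - f (u k)| + K * `|g (v k) - g (u k)|) < _).
  apply: ler_sum => k _; have [su [uvk vt]] := uv k.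
  have -> : f (v k) * g (v k) - f (u k) * g (u k) =
    (f (v k) - f (u k)) * g (v k) + f (u k) * (g (v k) - g (u k)) by ring.
  apply: le_trans (ler_normD _ _) _; rewrite !normrM lerD//.
    rewrite mulrC ler_wpM2r//; apply: le_trans (HM' _ _) _.
      by rewrite vt andbT (le_trans su).
    by rewrite /K; have := ler_norm M'; have := normr_ge0 M; lra.
  rewrite ler_wpM2r//; apply: le_trans (HM _ _) _.
    by rewrite su (le_trans uvk).
  by rewrite /K; have := ler_norm M; have := normr_ge0 M'; lra.
rewrite big_split/= -!mulr_sumr.
have := H n u v uv dis ld; have := H' n u v uv dis ld'.
rewrite !ltr_pdivlMr// ![_ * K]mulrC; lra.
Qed.

(** By the mean value theorem [f] is Lipschitz on $[s,t]$, with a bound of $|g|$ as constant. *)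
Lemma is_derive_abs_cont_on s t f g : (forall x, is_derive x 1 f (g x)) -> continuous g ->
  abs_cont_on s t f.
Proof.
move=> df cg.
have cf : continuous f.
  by move=> x; apply/differentiable_continuous/derivable1_diffP; exact: ex_derive.
have [M M0 HM] : exists2 M : R, 0 < M & forall x, x \in `[s, t]%R -> `|g x| <= M.
  have [st|ts] := leP s t; last by exists 1 => // x; rewrite in_itv/= => /andP[]; lra.
  have [c _ Hc] := EVT_max st (continuous_subspaceT
    (fun x => continuous_comp (cg x) (@norm_continuous _ _ _))).
  (* Adding $1$ keeps the constant positive even if [g] vanishes on the interval. *)
  exists (`|g c| + 1) => [|x /Hc/=]; [|lra].
  by have := normr_ge0 (g c); lra.
move=> e e0; exists (e / M); first exact: divr_gt0.
move=> n u v uv dis; rewrite ltr_pdivlMr// => H.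
apply: le_lt_trans H; rewrite mulr_suml; apply: ler_sum => k _.
have [su [uvk vt]] := uv k.
have [c] := MVT_segment uvk (fun x _ => df x) (continuous_subspaceT cf).
rewrite in_itv/= => /andP[uc cv] ->; rewrite normrM mulrC [`|v k - _|]ger0_norm ?subr_ge0//.
by rewrite ler_wpM2l ?subr_ge0// HM// in_itv/= (le_trans su)// (le_trans cv).
Qed.

End AbsoluteContinuity.

(** * The equation on an edge *)

Section FundamentalSystem.
Variable R : realType.
Implicit Types (x y lam kappa p q : R) (c s f g : R -> R).
Local Notation mu := (@lebesgue_measure R).
Local Open Scope classical_set_scope.

(** The last clause says that the Wronskian $c s' - c' s$ equals $1$. With these clauses as an
    interface, both signs of [lam] are treated at once. *)
Definition fundamental_system lam c s : Prop :=
  [/\ (forall x, is_derive x 1 c (- (lam * s x))), (forall x, is_derive x 1 s (c x)),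
      c 0 = 1, s 0 = 0 & forall x, c x ^+ 2 + lam * s x ^+ 2 = 1].

Lemma is_derive_continuous f g : (forall x, is_derive x 1 f (g x)) -> continuous f.
Proof.
by move=> df x; apply/differentiable_continuous/derivable1_diffP; exact: ex_derive.
Qed.

Lemma is_derive_add f g x d d' : is_derive x 1 f d -> is_derive x 1 g d' ->
  is_derive x 1 (fun y => f y + g y) (d + d').
Proof. by move=> df dg; exact: (@is_deriveD R R R f g x 1 d d' df dg). Qed.

Lemma is_derive_mulc f kappa x d : is_derive x 1 f d ->
  is_derive x 1 (fun y => kappa * f y) (kappa * d).
Proof. by move=> df; exact: (@is_deriveZ R R R f kappa x 1 d df). Qed.

Lemma is_derive_mul f g x d d' : is_derive x 1 f d -> is_derive x 1 g d' ->
  is_derive x 1 (fun y => f y * g y) (f x * d' + g x * d).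
Proof. by move=> df dg; exact: (@is_deriveM R R f g x 1 d d' df dg). Qed.

Lemma is_derive_scaled f g kappa x : is_derive (kappa * x) 1 f (g (kappa * x)) ->
  is_derive x 1 (fun y => f (kappa * y)) (kappa * g (kappa * x)).
Proof.
move=> df; have dk : is_derive x 1 (fun y => kappa * y) kappa.
  by apply: (is_derive_eq (is_derive_mulc kappa (is_derive_id x 1))); rewrite mulr1.
by apply: (is_derive_eq (is_derive1_comp df dk)); rewrite mulrC.
Qed.

Lemma is_derive_derive1 x f d : is_derive x 1 f d -> derivable f x 1 /\ f^`() x = d.
Proof. by move=> df; split; [exact: ex_derive|rewrite derive1E derive_val]. Qed.

Lemma derive1_is_derive x f d : derivable f x 1 -> f^`() x = d -> is_derive x 1 f d.
Proof. by move=> df <-; rewrite derive1E; exact: derivableP. Qed.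

Lemma fundamental_trig kappa : kappa != 0 ->
  fundamental_system (kappa ^+ 2) (fun x => cos (kappa * x)) (fun x => kappa^-1 * sin (kappa * x)).
Proof.
move=> k0; split=> [x|x|||x]; rewrite ?mulr0 ?cos0 ?sin0 ?mulr0//.
- have H := @is_derive_scaled cos (fun y => - sin y) kappa x (is_derive_cos _).
  by apply: (is_derive_eq H); field.
- have H := @is_derive_scaled sin cos kappa x (is_derive_sin _).
  by apply: (is_derive_eq (is_derive_mulc kappa^-1 H)); rewrite /GRing.scale/= mulrA mulVf// mul1r.
- by rewrite exprMn exprVn mulrA divff ?expf_neq0// mul1r cos2Dsin2.
Qed.

Lemma is_derive_expR_scaled kappa x :
  is_derive x 1 (fun y => expR (kappa * y)) (kappa * expR (kappa * x)).
Proof. exact: (is_derive_scaled (g := expR)). Qed.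

(** These are $\cosh(\kappa x)$ and $\kappa^{-1}\sinh(\kappa x)$; the factor $-1$ stays a scalar
    multiple so that the derivative rules above apply directly. *)
Lemma fundamental_hyp kappa : kappa != 0 ->
  fundamental_system (- kappa ^+ 2) (fun x => 2^-1 * (expR (kappa * x) + expR (- kappa * x)))
    (fun x => (2 * kappa)^-1 * (expR (kappa * x) + -1 * expR (- kappa * x))).
Proof.
move=> k0; split=> [x|x|||x]; rewrite ?mulr0 ?expR0 ?mulr1 ?subrr ?mulr0//; last 2 first.
- by field.
- rewrite (mulNr kappa x) expRN; have := expR_gt0 (kappa * x); set E := expR _ => E0.
  by field; rewrite k0 gt_eqF.
- have H1 := is_derive_expR_scaled kappa x; have H2 := is_derive_expR_scaled (- kappa) x.
  by apply: (is_derive_eq (is_derive_mulc 2^-1 (is_derive_add H1 H2))); field.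
- have H1 := is_derive_expR_scaled kappa x; have H2 := is_derive_expR_scaled (- kappa) x.
  by apply: (is_derive_eq (is_derive_mulc _ (is_derive_add H1 (is_derive_mulc (-1) H2)))); field.
Qed.

Lemma ode_unique lam c s f g x : fundamental_system lam c s -> 0 <= x ->
  abs_cont_on 0 x f -> abs_cont_on 0 x g ->
  (forall y, 0 < y < x -> derivable f y 1 /\ f^`() y = g y) ->
  {ae mu, forall y, 0 < y < x -> derivable g y 1 /\ g^`() y = - (lam * f y)} ->
  f x = f 0 * c x + g 0 * s x /\ g x = g 0 * c x - lam * f 0 * s x.
Proof.
move=> [dc ds c0 s0 cs] x0 acf acg df dg.
have cc : continuous c := is_derive_continuous dc.
have cts : continuous s := is_derive_continuous ds.
have acc : abs_cont_on 0 x c.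
  apply: is_derive_abs_cont_on dc _ => y; apply: cvgN; apply: cvgM; [exact: cvg_cst|exact: cts].
have acs : abs_cont_on 0 x s by exact: is_derive_abs_cont_on ds cc.
have acst a : abs_cont_on 0 x (cst a).
  by apply: (@is_derive_abs_cont_on _ _ _ _ (cst 0)) => y; exact: cst_continuous.
have H1 : c x * f x + (- 1) * (s x * g x) = c 0 * f 0 + (- 1) * (s 0 * g 0).
  apply: (@abs_cont_on_const _ _ _ (fun x => c x * f x + (- 1) * (s x * g x))) => //.
    apply: abs_cont_onD; first exact: abs_cont_onM.
    by apply: (@abs_cont_onM _ _ _ (cst (-1))) => //; exact: abs_cont_onM.
  apply: (@filterS _ _ (ae_filter_ringOfSetsType mu) _ _ _ dg) => y Hy y0x.
  have [dg1 dg2] := Hy y0x; have [df1 df2] := df y y0x.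
  apply: is_derive_derive1.
  have dfy := derive1_is_derive df1 df2; have dgy := derive1_is_derive dg1 dg2.
  apply: (is_derive_eq (is_derive_add (is_derive_mul (dc y) dfy)
    (is_derive_mulc (-1) (is_derive_mul (ds y) dgy)))).
  by ring.
have H2 : lam * (s x * f x) + c x * g x = lam * (s 0 * f 0) + c 0 * g 0.
  apply: (@abs_cont_on_const _ _ _ (fun x => lam * (s x * f x) + c x * g x)) => //.
    apply: abs_cont_onD; last exact: abs_cont_onM.
    by apply: (@abs_cont_onM _ _ _ (cst lam)) => //; exact: abs_cont_onM.
  apply: (@filterS _ _ (ae_filter_ringOfSetsType mu) _ _ _ dg) => y Hy y0x.
  have [dg1 dg2] := Hy y0x; have [df1 df2] := df y y0x.
  apply: is_derive_derive1.
  have dfy := derive1_is_derive df1 df2; have dgy := derive1_is_derive dg1 dg2.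
  apply: (is_derive_eq (is_derive_add (is_derive_mulc lam (is_derive_mul (ds y) dfy))
    (is_derive_mul (dc y) dgy))).
  by ring.
move: H1 H2; rewrite c0 s0 !mul0r !mulr0 !mul1r addr0 add0r => H1 H2.
(* The two conserved quantities form a linear system for [f x] and [g x] whose determinant is the
   Wronskian $1$; multiplying the unknown by it inverts the system. *)
have csx := cs x; split.
- rewrite -H1 -H2; transitivity ((c x ^+ 2 + lam * s x ^+ 2) * f x); last by ring.
  by rewrite csx mul1r.
- rewrite -H1 -H2; transitivity ((c x ^+ 2 + lam * s x ^+ 2) * g x); last by ring.
  by rewrite csx mul1r.
Qed.

(** The increment of [F] over $[0,x]$ is an integral of $g \geq 0$, hence at most the integral over
    the half-line. Square integrability is refuted below by exhibiting an unbounded antiderivative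
    of the square. *)
Lemma integral_half_line_bounded (F g : R -> R) : (forall x, is_derive x 1 F (g x)) ->
  continuous g -> (forall x, 0 <= g x) ->
  (\int[mu]_(x in `[0%R, +oo[) (g x)%:E < +oo)%E ->
  exists M : R, forall x, 0 < x -> F x <= M.
Proof.
move=> dF cg g0 ltI.
have I0 : (0 <= \int[mu]_(x in `[0%R, +oo[) (g x)%:E)%E.
  by apply: integral_ge0 => x _; rewrite lee_fin.
exists (fine (\int[mu]_(x in `[0%R, +oo[) (g x)%:E) + F 0) => x x0.
rewrite -lerBlDr -lee_fin fineK ?ge0_fin_numE// EFinB.
rewrite -(@continuous_FTC2 _ g F 0 x x0).
- apply: ge0_subset_integral => //.
  + apply/measurable_EFinP; apply: measurable_funTS; exact: continuous_measurable_fun.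
  + by move=> y _; rewrite lee_fin.
  + by move=> y /=; rewrite !in_itv/= => /andP[->].
- exact: continuous_subspaceT.
- have cF := is_derive_continuous dF; split.
  + by move=> y _; exact: ex_derive.
  + by apply: cvg_at_right_filter; exact: cF.
  + by apply: cvg_at_left_filter; exact: cF.
- by move=> y _; have [] := is_derive_derive1 (dF y).
Qed.

Lemma integral_expRN_lty kappa a : 0 < kappa -> 0 <= a ->
  (\int[mu]_(x in `[0%R, +oo[) (a * expR (- kappa * x))%:E < +oo)%E.
Proof.
move=> k0 a0.
have dF x : is_derive x 1 (fun y => - (a / kappa) * expR (- kappa * y)) (a * expR (- kappa * x)).
  have H := is_derive_expR_scaled (- kappa) x.
  by apply: (is_derive_eq (is_derive_mulc (- (a / kappa)) H)); field; rewrite gt_eqF.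
have cF := is_derive_continuous dF.
rewrite (@ge0_continuous_FTC2y _ _ (fun y => - (a / kappa) * expR (- kappa * y)) 0 0).
- by rewrite -EFinB ltry.
- by move=> x _; rewrite mulr_ge0// expR_ge0.
- apply: continuous_subspaceT => x; apply: cvgM; first exact: cvg_cst.
  exact: (is_derive_continuous (is_derive_expR_scaled (- kappa))).
- rewrite -[X in _ --> X](mulr0 (- (a / kappa))); apply: cvgM; first exact: cvg_cst.
  have H : (fun y : R => kappa * y) @ +oo%R --> +oo%R by apply: gt0_cvgMry.
  under eq_fun do rewrite mulNr.
  exact: (cvg_comp _ _ H (@cvgr_expR R)).
- by move=> x _; exact: ex_derive.
- by apply: cvg_at_right_filter; exact: cF.
- by move=> y _; have [] := is_derive_derive1 (dF y).
Qed.

End FundamentalSystem.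

(** * Complex solutions on an edge and their square integrability *)

Section EdgeSolutions.
Variable R : realType.
Local Notation C := R[i].
Local Notation mu := (@lebesgue_measure R).
Implicit Types (x y lam kappa : R) (c s : R -> R) (p q z : C) (J Jo : set R).
Local Open Scope classical_set_scope.

Let ReM x z : complex.Re (x%:C%C * z) = x * complex.Re z.
Proof. by case: z => a b /=; rewrite mul0r subr0. Qed.

Let ImM x z : complex.Im (x%:C%C * z) = x * complex.Im z.
Proof. by case: z => a b /=; rewrite mul0r addr0. Qed.

Let ReD z z' : complex.Re (z + z') = complex.Re z + complex.Re z'.
Proof. by case: z; case: z'. Qed.

Let ImD z z' : complex.Im (z + z') = complex.Im z + complex.Im z'.
Proof. by case: z; case: z'. Qed.

Let ReN z : complex.Re (- z) = - complex.Re z.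
Proof. by case: z. Qed.

Let ImN z : complex.Im (- z) = - complex.Im z.
Proof. by case: z. Qed.

(** For a fundamental system this is the solution with value [p] and slope [q] at $0$;
    differentiation turns the data $(p, q)$ into $(q, -\lambda p)$. *)
Definition edge_sol c s p q x : C := (c x)%:C%C * p + (s x)%:C%C * q.

Lemma Re_edge_sol c s p q x :
  complex.Re (edge_sol c s p q x) = complex.Re p * c x + complex.Re q * s x.
Proof. by rewrite /edge_sol ReD !ReM mulrC [s x * _]mulrC. Qed.

Lemma Im_edge_sol c s p q x :
  complex.Im (edge_sol c s p q x) = complex.Im p * c x + complex.Im q * s x.
Proof. by rewrite /edge_sol ImD !ImM mulrC [s x * _]mulrC. Qed.

Let Re_edge_sol_fun c s p q : (fun y => complex.Re (edge_sol c s p q y)) =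
  (fun y => complex.Re p * c y + complex.Re q * s y).
Proof. by apply/funext => y; rewrite Re_edge_sol. Qed.

Let Im_edge_sol_fun c s p q : (fun y => complex.Im (edge_sol c s p q y)) =
  (fun y => complex.Im p * c y + complex.Im q * s y).
Proof. by apply/funext => y; rewrite Im_edge_sol. Qed.

Lemma is_derive_edge_sol lam c s : fundamental_system lam c s -> forall p q x : R,
  is_derive x 1 (fun y => p * c y + q * s y) (q * c x + (- (lam * p)) * s x).
Proof.
move=> [dc ds _ _ _] p q x.
by apply: (is_derive_eq (is_derive_add (is_derive_mulc p (dc x)) (is_derive_mulc q (ds x)))); ring.
Qed.

Lemma continuous_edge_sol lam c s : fundamental_system lam c s -> forall p q : R,
  continuous (fun y => p * c y + q * s y).
Proof. by move=> fs p q; exact: is_derive_continuous (is_derive_edge_sol fs p q). Qed.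

Lemma cderive_edge_sol lam c s p q x : fundamental_system lam c s ->
  cderivable (edge_sol c s p q) x /\
  cderive (edge_sol c s p q) x = edge_sol c s q (- (lam%:C%C * p)) x.
Proof.
move=> fs.
have H1 := is_derive_derive1 (is_derive_edge_sol fs (complex.Re p) (complex.Re q) x).
have H2 := is_derive_derive1 (is_derive_edge_sol fs (complex.Im p) (complex.Im q) x).
have [E1 E2] := (Re_edge_sol_fun c s p q, Im_edge_sol_fun c s p q).
rewrite /cderivable /cderive E1 E2 H1.2 H2.2; split; first by split; [exact: H1.1|exact: H2.1].
apply/eqP; rewrite eq_complex [_ (_ +i* _)%C]/= [X in _ && (X == _)]/=.
by rewrite Re_edge_sol Im_edge_sol ReN ImN ReM ImM !eqxx.
Qed.

Lemma cabs_cont_edge_sol lam c s p q J : fundamental_system lam c s ->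
  cabs_cont J (edge_sol c s p q).
Proof.
move=> fs.
have [E1 E2] := (Re_edge_sol_fun c s p q, Im_edge_sol_fun c s p q).
split=> a b _ _.
  rewrite E1; apply: is_derive_abs_cont_on (is_derive_edge_sol fs _ _) _.
  exact: (continuous_edge_sol fs).
rewrite E2; apply: is_derive_abs_cont_on (is_derive_edge_sol fs _ _) _.
exact: (continuous_edge_sol fs).
Qed.

(** Differentiating twice multiplies both data by $-\lambda$, so the second [L2] hypothesis is the
    one on $\psi''$. *)
Lemma edge_eigen_sol lam c s p q J Jo : fundamental_system lam c s ->
  L2 J (edge_sol c s p q) -> L2 J (edge_sol c s (- (lam%:C%C * p)) (- (lam%:C%C * q))) ->
  edge_eigen J Jo lam (edge_sol c s p q) (edge_sol c s q (- (lam%:C%C * p))).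
Proof.
move=> fs L L'.
split => //.
- by split; apply: cabs_cont_edge_sol fs.
- by move=> x _; apply: cderive_edge_sol.
- apply: aeW => x _; have [d1 ->] := cderive_edge_sol q (- (lam%:C%C * p)) x fs; split => //.
  by rewrite /edge_sol; ring.
- suff -> : cderive (edge_sol c s q (- (lam%:C%C * p))) =
      edge_sol c s (- (lam%:C%C * p)) (- (lam%:C%C * q)) by [].
  by apply/funext => x; have [_ ->] := cderive_edge_sol q (- (lam%:C%C * p)) x fs.
Qed.

(** Since [lam] is real, real and imaginary parts solve the same real equation, and [ode_unique]
    applies to each. *)
Lemma edge_eigen_unique lam c s J Jo (psi dpsi : R -> C) x : fundamental_system lam c s ->
  edge_eigen J Jo lam psi dpsi -> 0 <= x -> J 0 -> J x -> (forall y, 0 < y < x -> Jo y) ->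
  psi x = edge_sol c s (psi 0) (dpsi 0) x /\
  dpsi x = edge_sol c s (dpsi 0) (- (lam%:C%C * psi 0)) x.
Proof.
move=> fs [[[acR acI] [adR adI]] dpsiE aedd _ _] x0 J0 Jx sub.
have [fR gR] : complex.Re (psi x) = complex.Re (psi 0) * c x + complex.Re (dpsi 0) * s x /\
   complex.Re (dpsi x) = complex.Re (dpsi 0) * c x - lam * complex.Re (psi 0) * s x.
  apply: (@ode_unique _ lam c s (fun y => complex.Re (psi y)) (fun y => complex.Re (dpsi y))) => //.
  - exact: acR.
  - exact: adR.
  - by move=> y /sub/dpsiE[[d1 d2] <-]; split; [exact: d1|].
  apply: (@filterS _ _ (ae_filter_ringOfSetsType mu) _ _ _ aedd) => y Hy /sub/Hy[[d1 d2] E].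
  split; first exact: d1.
  by rewrite -ReM -E ReN opprK.
have [fI gI] : complex.Im (psi x) = complex.Im (psi 0) * c x + complex.Im (dpsi 0) * s x /\
   complex.Im (dpsi x) = complex.Im (dpsi 0) * c x - lam * complex.Im (psi 0) * s x.
  apply: (@ode_unique _ lam c s (fun y => complex.Im (psi y)) (fun y => complex.Im (dpsi y))) => //.
  - exact: acI.
  - exact: adI.
  - by move=> y /sub/dpsiE[[d1 d2] <-]; split; [exact: d2|].
  apply: (@filterS _ _ (ae_filter_ringOfSetsType mu) _ _ _ aedd) => y Hy /sub/Hy[[d1 d2] E].
  split; first exact: d2.
  by rewrite -ImM -E ImN opprK.
split; apply/eqP; rewrite eq_complex Re_edge_sol Im_edge_sol ?ReN ?ImN ?ReM ?ImM.
  by rewrite fR fI !eqxx.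
by rewrite gR gI !mulNr !eqxx.
Qed.

Lemma L2_ext J (f g : R -> C) : {in J, f =1 g} -> L2 J f -> L2 J g.
Proof.
move=> fg; rewrite /L2; congr (_ < _)%E.
by apply: eq_integral => x xJ; rewrite fg.
Qed.

Let measurable_sq (f : R -> R) J : continuous f -> measurable_fun J (fun x => (f x ^+ 2)%:E).
Proof.
move=> cf; apply/measurable_EFinP; apply: measurable_funTS; apply: continuous_measurable_fun.
by move=> x; apply: cvgM; exact: cf.
Qed.

Lemma L2_edge_sol lam c s p q J : measurable J -> fundamental_system lam c s ->
  L2 J (edge_sol c s p q) <->
  (\int[mu]_(x in J) ((complex.Re p * c x + complex.Re q * s x) ^+ 2)%:E < +oo /\
   \int[mu]_(x in J) ((complex.Im p * c x + complex.Im q * s x) ^+ 2)%:E < +oo)%E.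
Proof.
move=> mJ fs; rewrite /L2.
under eq_integral do rewrite Re_edge_sol Im_edge_sol EFinD.
rewrite ge0_integralD//; last 4 first.
- by move=> x _; rewrite lee_fin sqr_ge0.
- by apply: measurable_sq; exact: (continuous_edge_sol fs).
- by move=> x _; rewrite lee_fin sqr_ge0.
- by apply: measurable_sq; exact: (continuous_edge_sol fs).
set a := integral _ _ _; set b := integral _ _ _.
have a0 : (0 <= a)%E by apply: integral_ge0 => x _; rewrite lee_fin sqr_ge0.
have b0 : (0 <= b)%E by apply: integral_ge0 => x _; rewrite lee_fin sqr_ge0.
split=> [ab|[aoo boo]]; last exact: lte_add_pinfty.
by split; apply: le_lt_trans ab; rewrite ?leeDl ?leeDr.
Qed.

Lemma L2_edge_sol_bounded lam c s p q (a : R) : fundamental_system lam c s ->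
  L2 `[0, a] (edge_sol c s p q).
Proof.
move=> fs; apply/(L2_edge_sol _ _ _ fs) => //.
have H (u v : R) : (\int[mu]_(x in `[0%R, a]) ((u * c x + v * s x) ^+ 2)%:E < +oo)%E.
  have : mu.-integrable `[0, a] (EFin \o (fun x => (u * c x + v * s x) ^+ 2)).
    apply: continuous_compact_integrable; first exact: segment_compact.
    apply: continuous_subspaceT => x; have cf := @continuous_edge_sol lam c s fs u v.
    by apply: cvgM; exact: cf.
  move=> /integrableP[_]; under eq_integral do rewrite /= ger0_norm ?sqr_ge0//.
  done.
by split; exact: H.
Qed.

(** The energy $E = g^2 + \lambda f^2$ with $g = f'$ is constant, and $f^2$ has the antiderivative
    $(E x - f g)/(2\lambda)$. As $f g$ is bounded, this stays bounded above only if $E = 0$. *)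
Lemma trig_L2_half_line kappa (p q : R) : kappa != 0 ->
  (\int[mu]_(x in `[0%R, +oo[)
     ((p * cos (kappa * x) + q * (kappa^-1 * sin (kappa * x))) ^+ 2)%:E < +oo)%E ->
  p = 0 /\ q = 0.
Proof.
move=> k0.
move: (fundamental_trig k0); set c := (fun x : R => cos _).
set s := (fun x : R => kappa^-1 * _); set lam := kappa ^+ 2.
move=> fs ltI; have [_ _ _ _ cs] := fs.
have lam0 : 0 < lam by rewrite /lam exprn_even_gt0.
pose f x := p * c x + q * s x; pose g x := q * c x + - (lam * p) * s x.
pose E := q ^+ 2 + lam * p ^+ 2.
have EE x : g x ^+ 2 + lam * f x ^+ 2 = E.
  by rewrite /E -[RHS]mulr1 -(cs x) /f /g; ring.
have df x : is_derive x 1 f (g x) by exact: is_derive_edge_sol.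
have dg x : is_derive x 1 g (- (lam * f x)).
  by apply: (is_derive_eq (is_derive_edge_sol fs q (- (lam * p)) x)); rewrite /f; ring.
have dF x : is_derive x 1 (fun y => (2 * lam)^-1 * (E * y + -1 * (f y * g y))) (f x ^+ 2).
  apply: (is_derive_eq (is_derive_mulc _ (is_derive_add (is_derive_mulc E (is_derive_id x 1))
    (is_derive_mulc (-1) (is_derive_mul (df x) (dg x)))))).
  by rewrite -(EE x); field; rewrite gt_eqF.
have cf2 : continuous (fun x => f x ^+ 2).
  by move=> x; apply: cvgM; exact: (is_derive_continuous df).
have [M HM] := integral_half_line_bounded dF cf2 (fun x => sqr_ge0 (f x)) ltI.
have bnd x : f x * g x <= (E / lam + E).
  have f2 : f x ^+ 2 <= E / lam by rewrite ler_pdivlMr// -(EE x) mulrC lerDr sqr_ge0.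
  have g2 : g x ^+ 2 <= E by rewrite -(EE x) lerDl mulr_ge0// ?sqr_ge0// ltW.
  by have := sqr_ge0 (f x - g x); nra.
have E0 : 0 <= E.
  rewrite -(EE 0); have := sqr_ge0 (g 0).
  by have := mulr_ge0 (ltW lam0) (sqr_ge0 (f 0)); lra.
have {E0} E0 : E = 0.
  apply/eqP; rewrite eq_le E0 andbT leNgt; apply/negP => Egt0.
  (* At $x = K/E$ the linear term $E x = K$ exceeds $2\lambda M$ plus the bound on $f g$. *)
  pose K := `|2 * lam * M| + (E / lam + E) + 1.
  have K0 : 0 < K.
    by rewrite /K; have := normr_ge0 (2 * lam * M); have := divr_gt0 Egt0 lam0; lra.
  have := HM (K / E) (divr_gt0 K0 Egt0); rewrite ler_pdivrMl; last by rewrite pmulr_rgt0.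
  rewrite [E * _]mulrC divfK ?gt_eqF//.
  by have := bnd (K / E); have := ler_norm (2 * lam * M); rewrite /K; lra.
have q0 : q ^+ 2 = 0.
  apply/eqP; rewrite eq_le sqr_ge0 andbT -[X in _ <= X]E0 /E lerDl.
  exact: (mulr_ge0 (ltW lam0) (sqr_ge0 p)).
move: E0; rewrite /E q0 add0r => /eqP; rewrite mulf_eq0 gt_eqF//= sqrf_eq0 => /eqP ->.
by split => //; apply/eqP; rewrite -sqrf_eq0 q0.
Qed.

(** In exponential form the solution is $u e^{\kappa x} + v e^{-\kappa x}$, and the claim is $u =
    0$. If not, the term $u^2 e^{2\kappa x}/(2\kappa)$ in the antiderivative [F] of the square
    outgrows all others. *)
Lemma hyp_L2_half_line kappa (p q : R) : 0 < kappa ->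
  (\int[mu]_(x in `[0%R, +oo[) ((p * (2^-1 * (expR (kappa * x) + expR (- kappa * x))) +
     q * ((2 * kappa)^-1 * (expR (kappa * x) + -1 * expR (- kappa * x)))) ^+ 2)%:E < +oo)%E ->
  q = - kappa * p.
Proof.
move=> k0.
have kn0 : kappa != 0 by rewrite gt_eqF.
pose u := (p + q / kappa) / 2; pose v := (p - q / kappa) / 2.
pose e x := expR (kappa * x); pose d x := expR (- kappa * x).
have ed x : e x * d x = 1 by rewrite /e /d mulNr expRN divff// gt_eqF ?expR_gt0.
under eq_integral => x _.
  have -> : p * (2^-1 * (expR (kappa * x) + expR (- kappa * x))) +
     q * ((2 * kappa)^-1 * (expR (kappa * x) + -1 * expR (- kappa * x))) = u * e x + v * d x.
    by rewrite /u /v /e /d; field.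
  over.
move=> ltI.
have de x : is_derive x 1 e (kappa * e x) by exact: is_derive_expR_scaled.
have dd x : is_derive x 1 d (- kappa * d x) by exact: is_derive_expR_scaled.
pose F x := u ^+ 2 / (2 * kappa) * (e x * e x) +
  (2 * u * v * x + - (v ^+ 2 / (2 * kappa)) * (d x * d x)).
have dF x : is_derive x 1 F ((u * e x + v * d x) ^+ 2).
  apply: (is_derive_eq (is_derive_add (is_derive_mulc _ (is_derive_mul (de x) (de x)))
    (is_derive_add (is_derive_mulc _ (is_derive_id x 1))
      (is_derive_mulc _ (is_derive_mul (dd x) (dd x)))))).
  transitivity (u ^+ 2 * e x ^+ 2 + 2 * u * v * (e x * d x) + v ^+ 2 * d x ^+ 2); last by ring.
  by rewrite ed; field.
have cf : continuous (fun x => (u * e x + v * d x) ^+ 2).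
  have df x := is_derive_add (is_derive_mulc u (de x)) (is_derive_mulc v (dd x)).
  by move=> x; apply: cvgM; exact: (is_derive_continuous df).
have [M HM] := integral_half_line_bounded dF cf (fun x => sqr_ge0 _) ltI.
suff u0 : u = 0.
  move: u0; rewrite /u => /eqP; rewrite mulf_eq0 invr_eq0 (pnatr_eq0 R 2) orbF => /eqP H.
  by have -> : p = - (q / kappa) by [lra]; field.
apply/eqP/negP => /negP un0.
have u2 : 0 < u ^+ 2 by rewrite exprn_even_gt0.
(* With $y = \kappa x = K/u^2$ and $e^{y} \geq 1 + y$, the leading term of $2\kappa F$ is at least
   $u^2 (1+y)^2 = u^2 + 2K + K y$. Here $K y$ absorbs the cross term $4 u v y$, and $2K$ exceeds
   $2\kappa M + v^2$. *)
pose K := 4 * `|u * v| + `|2 * kappa * M + v ^+ 2| + 1.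
have K1 : 1 <= K.
  by rewrite /K; have := normr_ge0 (u * v); have := normr_ge0 (2 * kappa * M + v ^+ 2); lra.
pose y := K / u ^+ 2; have y0 : 0 < y by apply: divr_gt0 => //; lra.
have uy : u ^+ 2 * y = K by rewrite /y mulrC divfK// gt_eqF.
have := HM (y / kappa) (divr_gt0 y0 k0); rewrite /F.
have e1 : 1 + y <= e (y / kappa).
  rewrite /e mulrC divfK//; exact: expR_ge1Dx.
have d1 : d (y / kappa) <= 1.
  by rewrite /d mulNr mulrC divfK// expR_le1; lra.
have d0 : 0 <= d (y / kappa) by exact: expR_ge0.
have e2 : (1 + y) ^+ 2 <= e (y / kappa) * e (y / kappa) by rewrite expr2 ler_pM//; lra.
have d2 : d (y / kappa) * d (y / kappa) <= 1 by rewrite mulr_ile1.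
set e' := e _ * e _ in e2 *; set d' := d _ * d _ in d2 *.
rewrite -(ler_pM2l (x := 2 * kappa)) ?mulr_gt0//.
have -> : 2 * kappa * (u ^+ 2 / (2 * kappa) * e' +
    (2 * u * v * (y / kappa) + - (v ^+ 2 / (2 * kappa)) * d'))
   = u ^+ 2 * e' + 4 * (u * v) * y - v ^+ 2 * d' by field.
have h1 : u ^+ 2 * (1 + y) ^+ 2 <= u ^+ 2 * e' by rewrite ler_pM2l.
have h2 : v ^+ 2 * d' <= v ^+ 2 by rewrite ler_piMr ?sqr_ge0.
have h3 : - (`|u * v| * y) <= u * v * y.
  by rewrite -mulNr ler_pM2r//; have := ler_norm (- (u * v)); rewrite normrN; lra.
have h4 : u ^+ 2 * (1 + y) ^+ 2 = u ^+ 2 + 2 * K + K * y.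
  by rewrite -uy; ring.
have h5 : K * y = 4 * (`|u * v| * y) + `|2 * kappa * M + v ^+ 2| * y + y by rewrite /K; ring.
have h6 : 0 <= `|2 * kappa * M + v ^+ 2| * y by rewrite mulr_ge0// ltW.
have h7 := ler_norm (2 * kappa * M + v ^+ 2).
have h8 : `|2 * kappa * M + v ^+ 2| <= K by rewrite /K; have := normr_ge0 (u * v); lra.
lra.
Qed.

End EdgeSolutions.

(** * The wave $e^{ikx}$ and the square integrable solutions on a half-line *)

Section WaveSystem.
Variable R : realType.
Local Notation C := R[i].
Local Notation mu := (@lebesgue_measure R).
Local Open Scope classical_set_scope.

(** For the slope $-\kappa p$ the growing exponential cancels and $p e^{-\kappa x}$ remains. *)
Lemma hyp_L2_decay (kappa p : R) : 0 < kappa ->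
  (\int[mu]_(x in `[0%R, +oo[) ((p * (2^-1 * (expR (kappa * x) + expR (- kappa * x))) +
     (- kappa * p) * ((2 * kappa)^-1 *
       (expR (kappa * x) + -1 * expR (- kappa * x)))) ^+ 2)%:E < +oo)%E.
Proof.
move=> k0; have kn0 : kappa != 0 by rewrite gt_eqF.
under eq_integral => x _.
  have -> : (p * (2^-1 * (expR (kappa * x) + expR (- kappa * x))) +
     (- kappa * p) * ((2 * kappa)^-1 * (expR (kappa * x) + -1 * expR (- kappa * x)))) ^+ 2
     = p ^+ 2 * expR (- (2 * kappa) * x).
    have -> : - (2 * kappa) * x = - kappa * x + - kappa * x by ring.
    by rewrite expRD; field.
  over.
by apply: integral_expRN_lty; rewrite ?mulr_gt0 ?sqr_ge0.
Qed.

(** The analytic facts on which the matrix argument rests, uniformly for real and imaginary [k]: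
    $e^{ikx}$ is the solution with data $(1, ik)$, and the square integrable solutions on a
    half-line are its multiples if $\operatorname{Im} k \neq 0$, and only zero if [k] is real. *)
Definition wave_system (k : C) (c s : R -> R) : Prop :=
  [/\ fundamental_system (complex.Re (k ^+ 2)) c s,
      (forall x : R, cexp ('i%C * k * (x%:C)%C) = (c x)%:C%C + 'i%C * k * (s x)%:C%C),
      (forall p q : C, L2 `[0, +oo[ (edge_sol c s p q) ->
         q = 'i%C * k * p /\ (complex.Im k = 0 -> p = 0)) &
      (complex.Im k != 0 -> forall p : C, L2 `[0, +oo[ (edge_sol c s p ('i%C * k * p)))].

(** For $k = a + ib$ the reality of $k^2$ means $2ab = 0$. Thus either [k] is real and nonzero, with
    trigonometric solutions, or $k = ib$ with $b > 0$, with hyperbolic ones. *)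
Lemma wave_system_exists (k : C) : 0 <= complex.Im k -> complex.Im (k ^+ 2) = 0 ->
  k ^+ 2 != 0 -> exists c s, wave_system k c s.
Proof.
case: k => a b /= b0 ab; rewrite sqrf_eq0 => k0.
have [b_eq|bn0] := eqVneq b 0.
  rewrite {}b_eq in b0 ab k0 *.
  have an0 : a != 0 by apply: contraNneq k0 => ->.
  have lamE : complex.Re ((a +i* 0)%C ^+ 2) = a ^+ 2 by rewrite /=; ring.
  have fs := fundamental_trig an0.
  exists (fun x => cos (a * x)), (fun x => a^-1 * sin (a * x)); split.
  - by rewrite lamE.
  - move=> x; rewrite /cexp /=; simpc => /=.
    by rewrite expR0 !mul1r mulrA mulfV// mul1r.
  - move=> p q /(L2_edge_sol _ _ _ fs)-/(_ (measurable_itv _))[].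
    move=> /(trig_L2_half_line an0)[pR qR] /(trig_L2_half_line an0)[pI qI].
    have -> : p = 0 by apply/eqP; rewrite eq_complex/= pR pI !eqxx.
    have -> : q = 0 by apply/eqP; rewrite eq_complex/= qR qI !eqxx.
    by rewrite mulr0.
  - by rewrite eqxx.
have bgt0 : 0 < b by rewrite lt_neqAle eq_sym bn0.
have a0 : a = 0.
  have : 2 * a * b = 0 by rewrite -[RHS]ab /=; ring.
  by move/eqP; rewrite !mulf_eq0 (pnatr_eq0 R 2) (negbTE bn0) orbF /= => /eqP.
rewrite {}a0 in ab k0 *.
have lamE : complex.Re ((0 +i* b)%C ^+ 2) = - b ^+ 2 by rewrite /=; ring.
have fs := fundamental_hyp bn0.
have wE : ('i * (0 +i* b))%C = (- b)%:C%C by rewrite /=; simpc.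
exists (fun x => 2^-1 * (expR (b * x) + expR (- b * x))),
  (fun x => (2 * b)^-1 * (expR (b * x) + -1 * expR (- b * x))); split.
- by rewrite lamE.
- move=> x; rewrite /cexp wE; simpc => /=; rewrite cos0 sin0 mulr1 mulr0.
  congr (_ +i* _)%C; field; exact: bn0.
- move=> p q /(L2_edge_sol _ _ _ fs)-/(_ (measurable_itv _))[].
  move=> /(hyp_L2_half_line bgt0) HR /(hyp_L2_half_line bgt0) HI; split; last by move/eqP: bn0.
  rewrite wE; apply/eqP; rewrite eq_complex HR HI; case: p {HR HI} => u v /=.
  by rewrite !mul0r subr0 addr0 !eqxx.
- move=> _ p; apply/(L2_edge_sol _ _ _ fs); first exact: measurable_itv.
  rewrite wE; case: p => u v /=; rewrite !mul0r subr0 addr0.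
  by split; exact: hyp_L2_decay.
Qed.

End WaveSystem.

(** * Boundary vectors and the scattering matrix *)

Section BoundaryVectors.
Variables (R : realType) (nE nI : nat).
Local Notation C := R[i].
Local Notation N := (nE + nI + nI)%N.
Implicit Types (f : 'I_nE -> C) (g h : 'I_nI -> C).

Lemma split_lshift m n (i : 'I_m) : fintype.split (lshift n i) = inl i.
Proof. exact: (unsplitK (inl i)). Qed.

Lemma split_rshift m n (i : 'I_n) : fintype.split (rshift m i) = inr i.
Proof. exact: (unsplitK (inr i)). Qed.

(** Indices of the three summands $\mathcal K_{\mathcal E}$, $\mathcal K^{(-)}_{\mathcal I}$,
    $\mathcal K^{(+)}_{\mathcal I}$. *)
Definition startE (e : 'I_nE) : 'I_N := lshift nI (lshift nI e).
Definition startI (i : 'I_nI) : 'I_N := lshift nI (rshift nE i).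
Definition stopI (i : 'I_nI) : 'I_N := rshift (nE + nI) i.

Lemma vertex_ind (P : 'I_N -> Prop) : (forall e, P (startE e)) -> (forall i, P (startI i)) ->
  (forall i, P (stopI i)) -> forall j, P j.
Proof.
move=> PE PM PP j; rewrite -(splitK j); case: (fintype.split j) => [j'|i]; last exact: PP.
rewrite /= -(splitK j'); case: (fintype.split j') => [e|i]; [exact: PE|exact: PM].
Qed.

Lemma bvec_startE f g h e : bvec f g h (startE e) 0 = f e.
Proof. by rewrite mxE !split_lshift. Qed.

Lemma bvec_startI f g h i : bvec f g h (startI i) 0 = g i.
Proof. by rewrite mxE split_lshift split_rshift. Qed.

Lemma bvec_stopI f g h i : bvec f g h (stopI i) 0 = h i.
Proof. by rewrite mxE split_rshift. Qed.

Definition bvecE := (bvec_startE, bvec_startI, bvec_stopI).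

Lemma bvec_eta (u : 'cV[C]_N) :
  u = bvec (fun e => u (startE e) 0) (fun i => u (startI i) 0) (fun i => u (stopI i) 0).
Proof. by apply/colP; apply: vertex_ind => j; rewrite bvecE. Qed.

Lemma sum_vertex (F : 'I_N -> C) :
  \sum_j F j = \sum_e F (startE e) + \sum_i F (startI i) + \sum_i F (stopI i).
Proof. by rewrite !big_split_ord. Qed.

Lemma Tmat_bvec k (a : 'I_nI -> R) f g h :
  Tmat nE k a *m bvec f g h =
  bvec (fun=> 0) (fun i => cexp ('i%C * k * (a i)%:C%C) * h i)
    (fun i => cexp ('i%C * k * (a i)%:C%C) * g i).
Proof.
apply/colP; apply: vertex_ind => j; rewrite bvecE mxE sum_vertex /Tmat.
- rewrite !big1 ?addr0// => i _; rewrite /startE /startI /stopI.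
  + by rewrite block_mxEur col_mxEu mxE mul0r.
  + by rewrite block_mxEul mxE mul0r.
  + by rewrite block_mxEul mxE mul0r.
- rewrite [X in X + _ + _]big1 ?add0r => [|i _]; last first.
    by rewrite /startI /startE block_mxEul mxE mul0r.
  rewrite [X in X + _]big1 ?add0r => [|i _]; last first.
    by rewrite /startI block_mxEul mxE mul0r.
  rewrite (bigD1 j)//= big1 ?addr0 => [|i ij].
    by rewrite bvec_stopI /startI /stopI block_mxEur col_mxEd !mxE eqxx mulr1n.
  by rewrite /startI /stopI block_mxEur col_mxEd mxE eq_sym (negbTE ij) mulr0n mul0r.
- rewrite [X in X + _ + _]big1 ?add0r => [|i _]; last first.
    by rewrite /stopI /startE block_mxEdl row_mxEl mxE mul0r.
  rewrite [X in _ + X]big1 ?addr0 => [|i _]; last first.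
    by rewrite /stopI block_mxEdr mxE mul0r.
  rewrite (bigD1 j)//= big1 ?addr0 => [|i ij].
    by rewrite bvec_startI /startI /stopI block_mxEdl row_mxEr !mxE eqxx mulr1n.
  by rewrite /startI /stopI block_mxEdl row_mxEr mxE eq_sym (negbTE ij) mulr0n mul0r.
Qed.

End BoundaryVectors.

(** * Unitarity of the scattering matrix for real $k$ *)

Section Unitarity.
Variable R : realType.
Local Notation C := R[i].

(** The squared Hermitian norm, kept in [C] so that it is an entry of a matrix product. *)
Definition hdot n (u : 'cV[C]_n) : C := \sum_j u j 0 * ((u j 0)^*)%C.

Lemma hdotE n (u : 'cV[C]_n) : hdot u = ((map_mx conjc u)^T *m u) 0 0.
Proof. by rewrite mxE; apply: eq_bigr => j _; rewrite !mxE mulrC. Qed.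

Lemma hdotN n (u : 'cV[C]_n) : hdot (- u) = hdot u.
Proof. by apply: eq_bigr => j _; rewrite !mxE rmorphN mulrNN. Qed.

Lemma mxadjM n (X Y : 'M[C]_n) : mxadj (X *m Y) = mxadj Y *m mxadj X.
Proof. by rewrite /mxadj map_mxM trmx_mul. Qed.

Lemma mxadjK n (X : 'M[C]_n) : mxadj (mxadj X) = X.
Proof. by apply/matrixP => i j; rewrite !mxE conjcK. Qed.

(* [(A + ikB)(A + ikB)^* = AA^* + k^2 BB^* = (A - ikB)(A - ikB)^*] since [AB^*] is self-adjoint. *)
Lemma hdot_Smat n (A B : 'M[C]_n) (a : R) (u : 'cV[C]_n) :
  mxadj (A *m mxadj B) = A *m mxadj B ->
  \det (A + ('i%C * a%:C%C) *: B) != 0 -> hdot (Smat a%:C%C A B *m u) = hdot u.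
Proof.
move=> sa detP; set w := 'i%C * a%:C%C in detP *.
pose P := A + w *: B; pose Q := A - w *: B.
have uP : P \in unitmx by rewrite unitmxE unitfE.
have wJ : (w^*)%C = - w by rewrite /w /=; simpc.
have BA : B *m mxadj A = A *m mxadj B by rewrite -sa mxadjM mxadjK.
have adjD z : mxadj (A + z *: B) = mxadj A + (z^*)%C *: mxadj B.
  by apply/matrixP => i j; rewrite !mxE rmorphD rmorphM.
have PQ : Q *m mxadj Q = P *m mxadj P.
  have wNJ : ((- w)^*)%C = w by rewrite /w /=; simpc.
  rewrite /Q /P -scaleNr !adjD wJ wNJ.
  rewrite !mulmxDl !mulmxDr -!scalemxAl -!scalemxAr BA !scaleNr !scalerN !scalerA.
  by rewrite !addrA addrK subrK.
pose U := invmx P *m Q.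
have UU : U *m mxadj U = 1%:M.
  rewrite mxadjM -mulmxA [Q *m _]mulmxA PQ -mulmxA -mxadjM mulVmx// [mxadj 1%:M](_ : _ = 1%:M).
    by rewrite mulmx1 mulVmx.
  by rewrite /mxadj map_mx1 trmx1.
(* For square matrices $U U^* = 1$ gives $U^* U = 1$, which is the form that preserves norms; here
   $U = -\mathfrak S$. *)
have {}UU := mulmx1C UU.
rewrite /Smat -/w -/P -/Q -/U mulNmx hdotN !hdotE map_mxM.
by rewrite trmx_mul mulmxA -[_ *m _ *m U]mulmxA [_ *m U]UU mulmx1.
Qed.

End Unitarity.

(** * Eigenfunctions as kernel vectors of a matrix *)

Section Correspondence.
Variables (R : realType) (nE nI : nat).
Local Notation C := R[i].
Local Notation N := (nE + nI + nI)%N.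
Variables (a : 'I_nI -> R) (k : C) (c s : R -> R).
Hypothesis a0 : forall i, 0 < a i.
Hypothesis k0 : k ^+ 2 != 0.
Hypothesis k2 : complex.Im (k ^+ 2) = 0.
Hypothesis ws : wave_system k c s.
Local Notation w := ('i%C * k).
Local Notation lam := (complex.Re (k ^+ 2)).
Local Notation T := (Tmat nE k a).
Local Notation phase i := (cexp (w * (a i)%:C%C)).
Implicit Type chi : 'cV[C]_N.

Let w2 : w ^+ 2 = - lam%:C%C.
Proof.
rewrite exprMn sqr_i mulN1r; congr (- _).
by apply/eqP; rewrite eq_complex/= k2 !eqxx.
Qed.

Let lamE : lam%:C%C = - w ^+ 2.
Proof. by rewrite w2 opprK. Qed.

Let w0 : w != 0.
Proof. by rewrite -sqrf_eq0 exprMn sqr_i mulN1r oppr_eq0. Qed.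

Let fs : fundamental_system lam c s. Proof. by case: ws. Qed.
Let cexpE x : cexp (w * x%:C%C) = (c x)%:C%C + w * (s x)%:C%C.
Proof. by case: ws. Qed.

(** Since $w^2 = -\lambda$, the product $(c - ws)(c + ws)$ is the Wronskian; the phase thus has an
    explicit inverse. *)
Let phaseV x : ((c x)%:C%C - w * (s x)%:C%C) * cexp (w * x%:C%C) = 1 :> C.
Proof.
have [_ _ _ _ cs] := fs.
have E (l u v : R) : ((u ^+ 2 + l * v ^+ 2)%:C)%C = u%:C%C ^+ 2 + l%:C%C * v%:C%C ^+ 2 :> C.
  by rewrite !expr2 rmorphD !rmorphM.
have := E lam (c x) (s x); rewrite cs (_ : (1%:C)%C = 1 :> C)// lamE cexpE => ->; ring.
Qed.

Let c00 : (c 0)%:C%C = 1 :> C. Proof. by have [_ _ -> _ _] := fs. Qed.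
Let s00 : (s 0)%:C%C = 0 :> C. Proof. by have [_ _ _ -> _] := fs. Qed.

(* Cauchy data at [0], on the internal edge [i], of the wave encoded by [chi]. *)
Definition edgeP chi i : C := chi (startI nE i) 0 + phase i * chi (stopI nE i) 0.
Definition edgeQ chi i : C := w * (chi (startI nE i) 0 - phase i * chi (stopI nE i) 0).
(** The entries of [chi] are amplitudes of waves leaving the vertices: the wave is $\chi_e e^{ikx}$
    on an external edge and $\chi^-_i e^{ikx} + \chi^+_i e^{ik(a_i - x)}$ on an internal one. *)
Definition waveE chi e : R -> C := edge_sol c s (chi (startE nI e) 0) (w * chi (startE nI e) 0).
Definition waveI chi i : R -> C := edge_sol c s (edgeP chi i) (edgeQ chi i).

Lemma TmatE chi : T *m chi = bvec (fun=> 0) (fun i => phase i * chi (stopI nE i) 0)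
  (fun i => phase i * chi (startI nE i) 0).
Proof. by rewrite {1}[chi]bvec_eta Tmat_bvec. Qed.

(** The boundary condition as a matrix acting on amplitudes. It contains no inverse, so it also
    serves when $A + ikB$ is singular. *)
Definition bdmx (A B : 'M[C]_N) := A *m (1%:M + T) + w *: (B *m (1%:M - T)).

Lemma boundary_val chi : bvec (fun e => chi (startE nI e) 0) (edgeP chi)
  (fun i => edge_sol c s (edgeP chi i) (edgeQ chi i) (a i)) = (1%:M + T) *m chi.
Proof.
rewrite mulmxDl mul1mx TmatE; apply/colP; apply: vertex_ind => j; rewrite bvecE mxE bvecE ?addr0//.
(* At the far end, inserting $1 = (c - ws)(c + ws)$ before the amplitude makes the claim a
   polynomial identity. *)
rewrite -[X in X + _]mul1r -(phaseV (a j)) cexpE /edge_sol /edgeP /edgeQ cexpE; ring.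
Qed.

Lemma boundary_der chi : bvec (fun e => w * chi (startE nI e) 0) (edgeQ chi)
  (fun i => - edge_sol c s (edgeQ chi i) (- (lam%:C%C * edgeP chi i)) (a i)) =
  w *: ((1%:M - T) *m chi).
Proof.
rewrite mulmxBl mul1mx TmatE; apply/colP; apply: vertex_ind => j.
all: rewrite bvecE 3!mxE bvecE ?subr0//.
rewrite -[X in X - _]mul1r -(phaseV (a j)) cexpE /edge_sol /edgeP /edgeQ cexpE.
rewrite lamE; ring.
Qed.

Lemma boundary_eq A B chi : A *m bvec (fun e => chi (startE nI e) 0) (edgeP chi)
  (fun i => edge_sol c s (edgeP chi i) (edgeQ chi i) (a i)) +
  B *m bvec (fun e => w * chi (startE nI e) 0) (edgeQ chi)
  (fun i => - edge_sol c s (edgeQ chi i) (- (lam%:C%C * edgeP chi i)) (a i)) = bdmx A B *m chi.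
Proof.
by rewrite boundary_val boundary_der -scalemxAr /bdmx [RHS]mulmxDl -scalemxAl !mulmxA.
Qed.

Lemma edge_sol0 p q : edge_sol c s p q 0 = p.
Proof. by rewrite /edge_sol c00 s00 mul1r mul0r addr0. Qed.

Lemma is_eigfun_wave A B chi : bdmx A B *m chi = 0 ->
  (complex.Im k = 0 -> forall e, chi (startE nI e) 0 = 0) ->
  is_eigfun a A B lam (waveE chi) (waveI chi).
Proof.
move=> chi0 chiE.
exists (fun e => edge_sol c s (w * chi (startE nI e) 0) (- (lam%:C%C * chi (startE nI e) 0))),
  (fun i => edge_sol c s (edgeQ chi i) (- (lam%:C%C * edgeP chi i))); split.
(* Used for two amplitudes: $\chi_e$ for the wave and $-\lambda\chi_e$ for its second derivative. *)
- move=> e; have LE (p : C) : (complex.Im k = 0 -> p = 0) ->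
      L2 `[0, +oo[%classic (edge_sol c s p (w * p)).
    move=> p0; have [kr|ki] := eqVneq (complex.Im k) 0; last by have [_ _ _ H] := ws; exact: H.
    rewrite (p0 kr) mulr0.
    apply/(L2_edge_sol _ _ _ fs); first exact: measurable_itv.
    by split; rewrite integral0_eq// => x _; rewrite !mul0r addr0 expr0n.
  have L1 := LE (chi (startE nI e) 0) (fun kr => chiE kr e).
  have L2 := LE (- (lam%:C%C * chi (startE nI e) 0)).
  have E : w * - (lam%:C%C * chi (startE nI e) 0) = - (lam%:C%C * (w * chi (startE nI e) 0)).
    by ring.
  rewrite E in L2.
  apply: (edge_eigen_sol _ fs L1); apply: L2 => kr.
  by rewrite (chiE kr) mulr0 oppr0.
- by move=> i; apply: edge_eigen_sol fs _ _; exact: L2_edge_sol_bounded fs.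
rewrite -[RHS]chi0 -[RHS](boundary_eq A B chi); congr (_ + _); congr (_ *m _);
  by apply/colP; apply: vertex_ind => j; rewrite !bvecE /waveE /waveI ?edge_sol0.
Qed.

Lemma eigfun_wave A B psiE psiI : is_eigfun a A B lam psiE psiI ->
  exists chi, [/\ bdmx A B *m chi = 0, (forall e x, 0 <= x -> psiE e x = waveE chi e x) &
    forall i x, 0 <= x <= a i -> psiI i x = waveI chi i x].
Proof.
move=> [dE [dI [HE HI bd]]].
(* This is $(\underline\psi + \underline\psi'/w)/2$: the derivative changes sign at far ends, and on
   external edges square integrability gives $\psi' = w\psi$ at $0$. *)
pose chi : 'cV[C]_N := bvec (fun e => psiE e 0) (fun i => (psiI i 0 + dI i 0 / w) / 2)
  (fun i => (psiI i (a i) - dI i (a i) / w) / 2).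
have solE e x : 0 <= x -> psiE e x = edge_sol c s (psiE e 0) (dE e 0) x.
  move=> x0; apply: (edge_eigen_unique fs (HE e) x0 _ _ _).1; rewrite /= ?in_itv/= ?lexx ?x0//.
  by move=> y; rewrite /= in_itv/= => /andP[->].
have dE0 e : dE e 0 = w * psiE e 0.
  have [_ _ H _] := ws; apply: (H _ _ _).1.
  have [_ _ _ L _] := HE e; apply: L2_ext L => x; rewrite inE/= in_itv/= andbT => x0.
  exact: solE.
have solI i x : 0 <= x <= a i -> psiI i x = edge_sol c s (psiI i 0) (dI i 0) x /\
    dI i x = edge_sol c s (dI i 0) (- (lam%:C%C * psiI i 0)) x.
  move=> /andP[x0 xa]; apply: (edge_eigen_unique fs (HI i) x0).
  1,2: by rewrite /= in_itv/= ?lexx ?x0 ?xa ?(ltW (a0 i)).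
  by move=> y /andP[y0 yx]; rewrite /= in_itv/= y0; exact: lt_le_trans yx xa.
have phaseP i : phase i * chi (stopI nE i) 0 = (psiI i 0 - dI i 0 / w) / 2.
  have [|Ea da] := solI i (a i); first by rewrite lexx ltW.
  rewrite bvecE Ea da /edge_sol lamE mulrC -[RHS]mulr1 -[X in _ = _ * X](phaseV (a i)).
  by move: w0; set W := 'i%C * k => W0; field.
have PE i : edgeP chi i = psiI i 0.
  by rewrite /edgeP phaseP bvecE; move: w0; set W := 'i%C * k => W0; field.
have QE i : edgeQ chi i = dI i 0.
  by rewrite /edgeQ phaseP bvecE; move: w0; set W := 'i%C * k => W0; field.
exists chi; split.
- rewrite -(boundary_eq A B chi) -[RHS]bd; congr (_ + _); congr (_ *m _);
    apply/colP; apply: vertex_ind => j; rewrite !bvecE ?PE ?QE//.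
  + by have [|-> _] := solI j (a j) => //; rewrite lexx ltW.
  + by have [|_ ->] := solI j (a j) => //; rewrite lexx ltW.
- by move=> e x x0; rewrite solE// dE0 /waveE bvecE.
- by move=> i x /solI[-> _]; rewrite /waveI PE QE.
Qed.

Lemma waveE_sum n (d : 'I_n -> C) (chi : 'I_n -> 'cV[C]_N) e x :
  \sum_(l < n) d l * waveE (chi l) e x = waveE (\sum_(l < n) d l *: chi l) e x.
Proof.
rewrite /waveE /edge_sol summxE !mulr_sumr -big_split/=; apply: eq_bigr => l _.
by rewrite mxE; ring.
Qed.

Lemma waveI_sum n (d : 'I_n -> C) (chi : 'I_n -> 'cV[C]_N) i x :
  \sum_(l < n) d l * waveI (chi l) i x = waveI (\sum_(l < n) d l *: chi l) i x.
Proof.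
rewrite /waveI /edge_sol /edgeP /edgeQ !summxE mulrBr !mulr_sumr -sumrB -big_split/=.
rewrite !mulr_sumr -big_split/=; apply: eq_bigr => l _.
by rewrite !mxE; ring.
Qed.

(** The encoding is injective. On an internal edge the value at $0$ vanishes; were the slope
    nonzero, [s] would vanish on $[0, a_i]$, and by the mean value theorem so would $c = s'$ at an
    inner point, against the Wronskian. The invertible phase then recovers the amplitudes from the
    Cauchy data. *)
Lemma wave_eq0 chi : (forall e x, 0 <= x -> waveE chi e x = 0) ->
  (forall i x, 0 <= x <= a i -> waveI chi i x = 0) -> chi = 0.
Proof.
move=> HE HI.
have PQ0 i : edgeP chi i = 0 /\ edgeQ chi i = 0.
  have P0 : edgeP chi i = 0.
    by move: (HI i 0); rewrite /waveI edge_sol0; apply; rewrite lexx ltW.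
  split => //; apply: contrapT => /eqP Q0.
  have s0 x : 0 <= x <= a i -> s x = 0.
    move=> /HI/eqP; rewrite /waveI /edge_sol P0 mulr0 add0r mulf_eq0 (negbTE Q0) orbF.
    by move=> /eqP/complexI.
  have [_ ds _ _ cs] := fs.
  have [y] := MVT (a0 i) (fun x _ => ds x) (continuous_subspaceT (is_derive_continuous ds)).
  rewrite in_itv/= => /andP[y0 ya].
  rewrite !s0 ?lexx ?ltW// subrr subr0 => /esym/eqP.
  rewrite mulf_eq0 (gt_eqF (a0 i)) orbF => /eqP cy.
  have sy : s y = 0 by apply: s0; rewrite (ltW y0) (ltW ya).
  have := cs y; rewrite cy sy.
  by rewrite expr0n mulr0 addr0 => /esym/eqP; rewrite oner_eq0.
apply/colP; apply: vertex_ind => j; rewrite mxE.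
- by rewrite -(HE j 0 (lexx 0)) /waveE edge_sol0.
- have [P0 /eqP] := PQ0 j; rewrite mulf_eq0 (negbTE w0)/= => /eqP Q0.
  have -> : chi (startI nE j) 0 =
      (edgeP chi j + (chi (startI nE j) 0 - phase j * chi (stopI nE j) 0)) / 2.
    by rewrite /edgeP; field.
  by rewrite P0 Q0 addr0 mul0r.
- have [P0 /eqP] := PQ0 j; rewrite mulf_eq0 (negbTE w0)/= => /eqP Q0.
  have H : phase j * chi (stopI nE j) 0 = 0.
    have -> : phase j * chi (stopI nE j) 0 =
        (edgeP chi j - (chi (startI nE j) 0 - phase j * chi (stopI nE j) 0)) / 2.
      by rewrite /edgeP; field.
    by rewrite P0 Q0 subr0 mul0r.
  by rewrite -[LHS]mul1r -(phaseV (a j)) -mulrA H mulr0.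
Qed.

(** The encoding is linear and injective, so independent eigenfunctions correspond to independent
    kernel vectors. The hypothesis on real [k] makes every kernel vector yield a square integrable
    wave. Transposes appear because [kermx] acts on row vectors. *)
Lemma indep_eigfun_rank A B n :
  (complex.Im k = 0 -> forall chi, bdmx A B *m chi = 0 -> forall e, chi (startE nI e) 0 = 0) ->
  (exists (FE : 'I_n -> 'I_nE -> R -> C) (FI : 'I_n -> 'I_nI -> R -> C),
      (forall l, is_eigfun a A B lam (FE l) (FI l)) /\ lin_indep a FE FI) <->
  (n <= N - \rank (bdmx A B))%N.
Proof.
move=> HE; rewrite -mxrank_tr -mxrank_ker; set Z := bdmx A B in HE *.
split=> [[FE [FI [eig indep]]]|nr].
  have /choice[chi Hchi] l := eigfun_wave (eig l).
  pose X : 'M[C]_(n, N) := \matrix_(l < n) (chi l)^T.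
  have XK : (X <= kermx Z^T)%MS.
    apply/sub_kermxP/row_matrixP => l; rewrite row_mul rowK row0 -trmx_mul.
    by have [-> _ _] := Hchi l; rewrite trmx0.
  apply: leq_trans (mxrankS XK); rewrite row_leq_rank; apply: inj_row_free => v vX.
  have S0 : \sum_(l < n) v 0 l *: chi l = 0.
    apply: trmx_inj; rewrite trmx0 -vX mulmx_sum_row linear_sum; apply: eq_bigr => l _.
    by rewrite linearZ rowK.
  apply/rowP => l; rewrite mxE; apply: (indep (fun l => v 0 l)) => [e x x0|i x x0].
    transitivity (waveE (\sum_(l < n) v 0 l *: chi l) e x).
      by rewrite -waveE_sum; apply: eq_bigr => j _; have [_ HEj _] := Hchi j; rewrite HEj.
    by rewrite S0 /waveE /edge_sol mxE !mulr0 addr0.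
  transitivity (waveI (\sum_(l < n) v 0 l *: chi l) i x).
    by rewrite -waveI_sum; apply: eq_bigr => j _; have [_ _ HIj] := Hchi j; rewrite HIj.
  by rewrite S0 /waveI /edge_sol /edgeP /edgeQ !mxE !mulr0 subr0 mulr0 addr0 !mulr0 addr0.
(* The first [n] vectors of a basis of the kernel. *)
pose X : 'M[C]_(n, N) := pid_mx n *m row_base (kermx Z^T).
have fX : row_free X.
  by rewrite /row_free /X mxrankMfree ?row_base_free// rank_pid_mx.
have XK : (X <= kermx Z^T)%MS by rewrite (submx_trans (submxMl _ _))// eq_row_base.
pose chi l := (row l X)^T.
have Zchi l : Z *m chi l = 0.
  apply: trmx_inj; rewrite trmx_mul trmxK trmx0.
  by apply/sub_kermxP; apply: submx_trans (row_sub _ _) XK.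
exists (fun l => waveE (chi l)), (fun l => waveI (chi l)); split.
  by move=> l; apply: is_eigfun_wave => // kr e; exact: HE.
move=> d dE dI.
have S0 : \sum_(l < n) d l *: chi l = 0.
  by apply: wave_eq0 => [e x /(dE e)|i x /(dI i)]; rewrite ?waveE_sum ?waveI_sum.
have : \row_l d l = 0 :> 'rV_n.
  apply: (row_free_inj fX); rewrite mul0mx; apply: trmx_inj.
  rewrite trmx0 -[RHS]S0 mulmx_sum_row linear_sum; apply: eq_bigr => l _.
  by rewrite linearZ/= mxE.
by move=> /rowP H l; have := H l; rewrite !mxE.
Qed.

(** Multiplicity [m] means that the kernel dimension is at least [m] but not at least $m + 1$. *)
Lemma eig_mult_rank A B m :
  (complex.Im k = 0 -> forall chi, bdmx A B *m chi = 0 -> forall e, chi (startE nI e) 0 = 0) ->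
  eig_mult a A B lam m <-> (N - \rank (bdmx A B))%N = m.
Proof.
move=> HE; rewrite /eig_mult (indep_eigfun_rank m HE).
have H := indep_eigfun_rank m.+1 HE; split=> [[mr nr]|mE].
  apply/eqP; rewrite eqn_leq mr andbT leqNgt; apply/negP => /H[FE [FI [e l]]].
  exact: (nr FE FI e l).
split=> [|FE FI e l]; first by rewrite mE.
by have := H.1 (ex_intro _ FE (ex_intro _ FI (conj e l))); rewrite mE ltnn.
Qed.

End Correspondence.

(** * The kernel in terms of the scattering matrix *)

Section Secular.
Variables (R : realType) (nE nI : nat).
Local Notation C := R[i].
Local Notation N := (nE + nI + nI)%N.
Variables (k : C) (a : 'I_nI -> R) (A B : 'M[C]_N).
Local Notation T := (Tmat nE k a).

(** With $P = A + wB$ one has $P\mathfrak S = -(A - wB)$, so that $P(1 - \mathfrak S T) = P + (A -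
    wB)T$; it remains to regroup by [A] and [B]. *)
Lemma bdmx_factor : \det (A + ('i%C * k) *: B) != 0 ->
  bdmx a k A B = (A + ('i%C * k) *: B) *m (1%:M - Smat k A B *m T).
Proof.
move=> detP; set w := 'i%C * k in detP *; set P := A + w *: B in detP *.
have uP : P \in unitmx by rewrite unitmxE unitfE.
rewrite mulmxBr mulmx1 mulmxA /Smat -/w -/P mulmxN mulmxA mulmxV// mul1mx mulNmx opprK.
rewrite /bdmx -/w mulmxDr mulmx1 mulmxBr mulmx1 mulmxBl -scalemxAl scalerBr /P.
by rewrite addrACA.
Qed.

(** [eigenspace] consists of row vectors, but its dimension $N - \operatorname{rank}(\mathfrak S T -
    1)$ is also that of the column kernel; the invertible factor preserves the rank. *)
Lemma rank_bdmx : \det (A + ('i%C * k) *: B) != 0 ->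
  \rank (eigenspace (Smat k A B *m T) 1) = (N - \rank (bdmx a k A B))%N.
Proof.
move=> detP; rewrite mxrank_ker bdmx_factor//; congr (_ - _)%N.
rewrite -mxrank_opp opprB; symmetry; apply: (eqmxMfull _ _).1.
by rewrite row_full_unit unitmxE unitfE.
Qed.

Lemma bdmx_ker_external (chi : 'cV[C]_N) : complex.Im k = 0 ->
  mxadj (A *m mxadj B) = A *m mxadj B ->
  \det (A + ('i%C * k) *: B) != 0 -> bdmx a k A B *m chi = 0 ->
  forall e, chi (startE nI e) 0 = 0.
Proof.
move=> kr sa detP chi0.
have kE : k = (complex.Re k)%:C%C by apply/eqP; rewrite eq_complex/= kr !eqxx.
have uP : A + ('i%C * k) *: B \in unitmx by rewrite unitmxE unitfE.
have chiE : chi = Smat k A B *m (T *m chi).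
  move: chi0; rewrite bdmx_factor// -mulmxA => /(congr1 (mulmx (invmx (A + ('i%C * k) *: B)))).
  rewrite mulmx0 mulKmx// mulmxBl mul1mx => /eqP; rewrite subr_eq0 => /eqP {1}->.
  by rewrite mulmxA.
(* For real [k] the phases have modulus $1$, so [T] preserves the norm of the internal part. *)
have phase1 i z (E := cexp ('i%C * k * (a i)%:C%C)) : E * z * ((E * z)^*)%C = z * (z^*)%C.
  rewrite /E rmorphM /= mulrACA -[RHS]mul1r; congr (_ * _).
  rewrite kE /cexp /=; simpc => /=.
  rewrite expR0 !mul1r; apply/eqP; rewrite eq_complex /=; apply/andP; split; apply/eqP.
    by have := cos2Dsin2 (complex.Re k * a i); rewrite !expr2 => <-; ring.
  by ring.
have dE : hdot chi = hdot (T *m chi) by rewrite {1}chiE kE; rewrite hdot_Smat// -kE.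
move: dE; rewrite /hdot !sum_vertex TmatE.
under [X in _ = X + _ + _]eq_bigr do rewrite bvec_startE mul0r.
under [X in _ = _ + X + _]eq_bigr do rewrite bvec_startI phase1.
under [X in _ = _ + _ + X]eq_bigr do rewrite bvec_stopI phase1.
rewrite big1_eq add0r => /eqP; rewrite -subr_eq0 => /eqP H e.
(* Comparing norms leaves $\sum_e |\chi_e|^2 = 0$, a sum of nonnegative terms. *)
have S0 : \sum_e chi (startE nI e) 0 * ((chi (startE nI e) 0)^*)%C = 0.
  by rewrite -[RHS]H; ring.
have /eqP : chi (startE nI e) 0 * ((chi (startE nI e) 0)^*)%C = 0.
  by apply: (psumr_eq0P _ S0) => // j _; exact: mulcJ_ge0.
by rewrite mulf_eq0 conjc_eq0 orbb => /eqP.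
Qed.

End Secular.

Theorem theorem3p2 (R : realType) (nE nI : nat) (a : 'I_nI -> R)
  (Ha : forall i, 0 < a i) (A B : 'M[R[i]]_(nE + nI + nI))
  (Hrank : \rank (row_mx A B) = (nE + nI + nI)%N)
  (Hsa : mxadj (A *m mxadj B) = A *m mxadj B) :
  ((0 < nI)%N ->
    forall k : R[i], 0 <= complex.Im k -> complex.Im (k ^+ 2) = 0 -> k ^+ 2 != 0 ->
    \det (A + ('i%C * k) *: B) != 0 ->
    forall m : nat,
      eig_mult a A B (complex.Re (k ^+ 2)) m <->
      \rank (eigenspace (Smat k A B *m Tmat nE k a) 1) = m)
  /\
  (nI = 0%N ->
    forall kappa : R, 0 < kappa ->
    forall m : nat,
      eig_mult a A B (- kappa ^+ 2) m <->
      \rank (eigenspace (A - (kappa%:C)%C *: B) 0) = m).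
Proof.
split=> [_ k Imk Imk2 k0 detP m|nI0 kappa kappa0 m].
  have [c [s ws]] := wave_system_exists Imk Imk2 k0.
  rewrite rank_bdmx//; apply: (eig_mult_rank Ha k0 Imk2 ws) => kr chi chi0.
  exact: bdmx_ker_external kr Hsa detP chi0.
(* With $k = i\varkappa$ one gets $k^2 = -\varkappa^2$ and $ik = -\varkappa$. *)
pose k : R[i] := (0 +i* kappa)%C.
have k2 : k ^+ 2 = (- kappa ^+ 2)%:C%C by rewrite /k expr2; simpc.
have wE : 'i%C * k = (- kappa)%:C%C by rewrite /k; simpc.
have k0 : k ^+ 2 != 0.
  by rewrite k2 eq_complex/= oppr_eq0 sqrf_eq0 gt_eqF.
have [c [s ws]] : exists c s, wave_system k c s.
  by apply: wave_system_exists; rewrite // ?k2//= ltW.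
have -> : - kappa ^+ 2 = complex.Re (k ^+ 2) by rewrite k2.
have -> : \rank (eigenspace (A - (kappa%:C)%C *: B) 0) = (nE + nI + nI - \rank (bdmx a k A B))%N.
  rewrite mxrank_ker; congr (_ - \rank _)%N.
  (* Without internal edges [T] vanishes, and [bdmx] reduces to $A + ikB = A - \varkappa B$. *)
  have T0 : Tmat nE k a = 0.
    by subst nI; apply/matrixP => i j; move: i j; apply: vertex_ind => [e|[]//|[]//];
      apply: vertex_ind => [e'|[]//|[]//]; rewrite /startE /Tmat block_mxEul !mxE.
  by rewrite /bdmx T0 addr0 subr0 !mulmx1 wE raddf0 subr0 rmorphN scaleNr.
apply: (eig_mult_rank Ha k0 _ ws); first by rewrite k2.
(* The case of real [k] is excluded by $\operatorname{Im} k = \varkappa > 0$. *)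
by move=> /= kk; move: kappa0; rewrite kk ltxx.
Qed.
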